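(* Let $(X,g)$ be an oriented Riemannian manifold with a $\mathrm{Spin}^c$ bundle $W$ carrying a Hermitian metric, let $A$ be a Hermitian connection on the determinant bundle $\det_{\mathbb{C}}(W)$ with associated Dirac operator $D_A$ on $W$, and let $\psi\in\Gamma(W)$. On $\Gamma(W\oplus\Lambda^*_{\mathbb{C}}T^*X)$ put $$\mathcal{D}=\begin{pmatrix}D_A&0\\0&d+d^*\end{pmatrix},\qquad \mathcal{A}_\psi=\begin{pmatrix}0&P_\psi\\-P_\psi^*&0\end{pmatrix},$$ where $P_\psi:\Lambda^*_{\mathbb{C}}T^*X\to W$ is $P_\psi(b)=c(b)\psi$ and $P_\psi^*$ is its complex adjoint. Then $(\sigma_{\mathcal{D}},\mathcal{A}_\psi)$ is a concentrating pair.
   Context: $c:T^*X\to\mathrm{End}_{\mathbb{C}}(W)$ is Clifford multiplication, with $c(u)c(v)+c(v)c(u)=-2\langle u,v\rangle \mathrm{Id}$ and $c(v)^*=-c(v)$; it is extended to $c:\Lambda^*T^*X\to\mathrm{End}_{\mathbb{C}}(W)$ (and complex linearly to $\Lambda^*_{\mathbb{C}}T^*X$) by $c(e^{i_1}\wedge\dots\wedge e^{i_p})=c(e^{i_1})\cdots c(e^{i_p})$ for $i_1<\dots<i_p$ in an orthonormal coframe. $\sigma_{\mathcal{D}}$ denotes the symbol of $\mathcal{D}$, i.e. $\mathcal{D}(f\xi)=\sigma_{\mathcal{D}}(df)\xi+f\mathcal{D}\xi$; the symbol of $D_A$ is $c$ and the symbol of $d+d^*$ is $\hat c(v)=v\wedge\cdot-\iota_v$.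 A pair $(\sigma,\mathcal{A})$ is a concentrating pair if $\mathcal{A}^*\circ\sigma(u)=\sigma(u)^*\circ\mathcal{A}$ for every $u\in T^*X$. *)

(* Defs.v *)
From HB Require Import structures.
From mathcomp Require Import all_boot all_order all_algebra.
From mathcomp Require Import complex.
From mathcomp Require Import all_classical all_reals topology normedtype derive.

Set Implicit Arguments.
Unset Strict Implicit.
Unset Printing Implicit Defensive.

Import Order.TTheory GRing.Theory Num.Theory numFieldNormedType.Exports.
Local Open Scope ring_scope.
Local Open Scope classical_set_scope.

Section Euclidean.
Variables (R : realType) (n : nat).
Implicit Types (p : 'rV[R]_n) (j : 'I_n).

Definition partial (j : 'I_n) (f : 'rV[R]_n -> R) (p : 'rV[R]_n) : R :=
  'D_(delta_mx ord0 j) f p.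

(* [Ck k f p]: f is of class C^k on some neighbourhood of p. *)
Fixpoint Ck (k : nat) (f : 'rV[R]_n -> R) (p : 'rV[R]_n) : Prop :=
  (\forall q \near p, {for q, continuous f}) /\
  match k with
  | 0%N => True
  | k'.+1 =>
    (\forall q \near p, forall j, derivable f q (delta_mx ord0 j)) /\
    (forall j, Ck k' (partial j f) p)
  end.

(* f is C^oo on a neighbourhood of p *)
Definition smooth_at (f : 'rV[R]_n -> R) (p : 'rV[R]_n) : Prop :=
  \forall q \near p, forall k, Ck k f q.

Definition smoothC_at (f : 'rV[R]_n -> R[i]) (p : 'rV[R]_n) : Prop :=
  smooth_at (fun q => complex.Re (f q)) p /\
  smooth_at (fun q => complex.Im (f q)) p.

Definition partialC (j : 'I_n) (f : 'rV[R]_n -> R[i]) (p : 'rV[R]_n) : R[i] :=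
  Complex (partial j (fun q => complex.Re (f q)) p)
          (partial j (fun q => complex.Im (f q)) p).

End Euclidean.

Record chart (R : realType) (n : nat) (X : topologicalType) := Chart {
  cdom : set X;
  cmap : X -> 'rV[R]_n;
  cinv : 'rV[R]_n -> X;
  cdom_open : open cdom;
  cimg_open : open (cmap @` cdom);
  cmapK : forall x, cdom x -> cinv (cmap x) = x;
  cmap_cont : forall x, cdom x -> {for x, continuous cmap};
  cinv_cont : forall z, (cmap @` cdom) z -> {for z, continuous cinv} }.

Section Transition.
Variables (R : realType) (n : nat) (X : topologicalType).
Variable ch : X -> chart R n X.

Definition transition (x y : X) (q : 'rV[R]_n) : 'rV[R]_n :=
  cmap (ch y) (cinv (ch x) q).

(* Entry (i, j) is the derivative of the i-th coordinate of the chart at y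
   with respect to the j-th coordinate of the chart at x, at the point z. *)
Definition jacobian (x y z : X) : 'M[R]_n :=
  \matrix_(i < n, j < n)
    partial j (fun q => transition x y q ord0 i) (cmap (ch x) z).

End Transition.

(* The atlas is indexed by the points of X, the chart of index x being defined
   around x (any atlas contains such a family, which defines the same smooth
   structure). *)
Record oriented_manifold (R : realType) (n : nat) := OrientedManifold {
  carrier :> topologicalType;
  chart_at : carrier -> chart R n carrier;
  _ : hausdorff_space carrier;
  _ : @second_countable carrier;
  chart_at_dom : forall x, cdom (chart_at x) x;
  chart_at_smooth : forall (x y z : carrier) (i : 'I_n),
    cdom (chart_at x) z -> cdom (chart_at y) z ->
    smooth_at (fun q => transition chart_at x y q ord0 i)
              (cmap (chart_at x) z);
  chart_at_oriented : forall x y z : carrier,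
    cdom (chart_at x) z -> cdom (chart_at y) z ->
    0 < \det (jacobian chart_at x y z) }.

(* The fibre T^*_x X is 'rV[R]_n: u stands for the covector
   \sum_i u_i dx^i, where (x^i) are the coordinates of [chart_at x]. *)
Section Functions.
Variables (R : realType) (n : nat) (X : oriented_manifold R n).

Definition in_chart (T : Type) (x : X) (f : X -> T) (q : 'rV[R]_n) : T :=
  f (cinv (chart_at x) q).

Definition coord (x : X) : 'rV[R]_n := cmap (chart_at x) x.

Definition smooth_fun (f : X -> R) (x : X) : Prop :=
  smooth_at (in_chart x f) (coord x).

Definition smooth_funC (f : X -> R[i]) (x : X) : Prop :=
  smoothC_at (in_chart x f) (coord x).

Definition dfun (f : X -> R) (x : X) : 'rV[R]_n :=
  \row_j partial j (in_chart x f) (coord x).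

Definition dfunC (f : X -> R[i]) (x : X) : 'rV[R[i]]_n :=
  \row_j partialC j (in_chart x f) (coord x).

(* At a point y of the chart at x, passes from the coframe of [chart_at y] to
   that of [chart_at x]: dy^i = \sum_j (cochange x y)_ij dx^j. *)
Definition cochange (x y : X) : 'M[R]_n := jacobian (@chart_at _ _ X) x y y.

Definition covector_in_chart (x : X) (u : X -> 'rV[R]_n) (q : 'rV[R]_n) :
    'rV[R]_n :=
  in_chart x (fun y => u y *m cochange x y) q.

Definition smooth_covector (u : X -> 'rV[R]_n) (x : X) : Prop :=
  forall j, smooth_at (fun q => covector_in_chart x u q ord0 j) (coord x).

End Functions.

(* b : extform C n stands for \sum_I b_I dx^I with
   dx^I = dx^{i_1} /\ ... /\ dx^{i_p} for I = {i_1 < ... < i_p}. *)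
Definition extform (C : comNzRingType) (n : nat) : Type :=
  {ffun {set 'I_n} -> C^o}.

HB.instance Definition _ (C : comNzRingType) (n : nat) :=
  GRing.Lmodule.on (extform C n).

Section Exterior.
Variables (C : comNzRingType) (n : nat).

Definition form_one : extform C n :=
  [ffun I : {set 'I_n} => if I == finset.set0 then 1 else 0].

Definition ins_sign (k : 'I_n) (K : {set 'I_n}) : C :=
  (-1) ^+ #|[set j in K | (j < k)%N]%SET|.

(* v /\ b *)
Definition wedge (v : 'rV[C]_n) (b : extform C n) : extform C n :=
  [ffun K : {set 'I_n} =>
     \sum_(k in K) ins_sign k K * v ord0 k * b (K :\ k)%SET].

(* A_{i_1} /\ ... /\ A_{i_p} for I = {i_1 < ... < i_p}, A_i the i-th row of A;
   its coefficient on dx^J, #|J| = #|I|, is the (I, J) minor of A. *)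
Definition row_wedge (A : 'M[C]_n) (I : {set 'I_n}) : extform C n :=
  foldr (fun i b => wedge (row i A) b) form_one (enum I).

(* The algebra morphism with dx^i |-> A_i. *)
Definition form_map (A : 'M[C]_n) (b : extform C n) : extform C n :=
  \sum_(I : {set 'I_n}) b I *: row_wedge A I.

(* dx^I /\ dx^J = shuffle_sign I J * dx^(I :|: J) for disjoint I and J. *)
Definition shuffle_sign (I J : {set 'I_n}) : C :=
  (-1) ^+ #|[set p : 'I_n * 'I_n |
              [&& p.1 \in I, p.2 \in J & (p.2 < p.1)%N]]%SET|.

End Exterior.

Definition toC (R : realType) (m n : nat) (A : 'M[R]_(m, n)) :
    'M[R[i]]_(m, n) := map_mx (real_complex R) A.

Section MetricInCoordinates.
Variables (R : realType) (n : nat).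

(* g is the matrix of g_ij; dx^I and dx^J have inner product
   det (g^{ij})_{i in I, j in J}.  Complex bilinear and Hermitian extensions
   (the latter conjugate-linear on the left). *)
Definition form_pairing (g : 'M[R]_n) (a b : extform R[i] n) : R[i] :=
  \sum_(I : {set 'I_n}) \sum_(J : {set 'I_n})
     a I * row_wedge (toC (invmx g)) I J * b J.

Definition form_herm (g : 'M[R]_n) (a b : extform R[i] n) : R[i] :=
  form_pairing g [ffun I => Num.conj (a I)] b.

(* Complex linear Hodge star of the orientation dx^1 /\ ... /\ dx^n, given by
   a /\ * b = <a, b> sqrt(det g) dx^1 /\ ... /\ dx^n
   for a and b of the same degree. *)
Definition hodge (g : 'M[R]_n) (b : extform R[i] n) : extform R[i] n :=
  [ffun K : {set 'I_n} =>
     real_complex R (Num.sqrt (\det g)) *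
     shuffle_sign _ (~: K)%SET K *
     form_pairing g [ffun I => ((I == ~: K)%SET)%:R] b].

Definition ext_d (b : 'rV[R]_n -> extform R[i] n) (p : 'rV[R]_n) : extform R[i] n :=
  \sum_(j < n) wedge (delta_mx ord0 j)
     [ffun I => partialC j (fun q => b q I) p].

(* d^* = (-1)^(n (p + 1) + 1) * d * on p-forms, * being the Hodge star: the
   formal adjoint of d. *)
Definition codiff (g : 'rV[R]_n -> 'M[R]_n) (b : 'rV[R]_n -> extform R[i] n)
    (p : 'rV[R]_n) : extform R[i] n :=
  hodge (g p)
    (ext_d (fun q => hodge (g q)
       [ffun I : {set 'I_n} => (-1) ^+ (n * (#|I| + 1) + 1) * b q I]) p).

Definition christoffel (g : 'rV[R]_n -> 'M[R]_n) (k j l : 'I_n)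
    (p : 'rV[R]_n) : R :=
  2^-1 * \sum_(m < n) invmx (g p) k m *
    (partial j (fun q => g q m l) p + partial l (fun q => g q m j) p
     - partial m (fun q => g q j l) p).

End MetricInCoordinates.

Definition metric_in_chart (R : realType) (n : nat)
    (X : oriented_manifold R n) (g : X -> 'M[R]_n) (x : X) (q : 'rV[R]_n) :
    'M[R]_n :=
  in_chart x (fun y => (cochange x y)^T *m g y *m cochange x y) q.

(* [metric x] is the matrix of g_ij in the coordinates of [chart_at x]. *)
Record oriented_riemannian (R : realType) (n : nat) := OrientedRiemannian {
  manifold :> oriented_manifold R n;
  metric : manifold -> 'M[R]_n;
  metric_sym : forall x, (metric x)^T = metric x;
  metric_pos : forall x (v : 'rV[R]_n), v != 0 ->
    0 < (v *m metric x *m v^T) ord0 ord0;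
  metric_smooth : forall x i j,
    smooth_at (fun q => metric_in_chart metric x q i j) (coord x) }.

Section RiemannianForms.
Variables (R : realType) (n : nat) (X : oriented_riemannian R n).
Notation C := R[i].

Definition covector_dot (x : X) (u v : 'rV[R]_n) : R :=
  (u *m invmx (metric x) *m v^T) ord0 ord0.

(* The rows of e are the covectors e^1, ..., e^n. *)
Definition orthonormal_coframe (x : X) (e : 'M[R]_n) : Prop :=
  forall i j, covector_dot x (row i e) (row j e) = (i == j)%:R.

Definition LC_covector (u : X -> 'rV[R]_n) (x : X) (j : 'I_n) : 'rV[R]_n :=
  \row_l (partial j (fun q => covector_in_chart x u q ord0 l) (coord x)
    - \sum_(k < n)
        christoffel (metric_in_chart (@metric _ _ X) x) k j l (coord x)
        * u x ord0 k).

(* Sections of Lambda^*_C T^*X; the fibre at x uses the coframe of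
   [chart_at x]. *)
Definition form_in_chart (x : X) (b : X -> extform C n) (q : 'rV[R]_n) :
    extform C n :=
  in_chart x (fun y => form_map (toC (cochange x y)) (b y)) q.

Definition smooth_form (b : X -> extform C n) (x : X) : Prop :=
  forall I, smoothC_at (fun q => form_in_chart x b q I) (coord x).

Definition form_d (b : X -> extform C n) (x : X) : extform C n :=
  ext_d (form_in_chart x b) (coord x).

Definition form_dstar (b : X -> extform C n) (x : X) : extform C n :=
  codiff (metric_in_chart (@metric _ _ X) x) (form_in_chart x b) (coord x).

End RiemannianForms.

(* Every fibre is identified with 'cV[C]_r, with no regularity in the base
   point; the smooth structure is carried by local frames, one around each
   point x: the columns of [fmat x y] form a frame of the fibre at y. *)
Record local_frames (R : realType) (n : nat) (X : oriented_manifold R n)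
    (r : nat) := LocalFrames {
  fdom : X -> set X;
  fmat : X -> X -> 'M[R[i]]_r }.

Section Bundles.
Variables (R : realType) (n : nat) (X : oriented_manifold R n) (r : nat).
Notation C := R[i].

Definition is_vector_bundle (F : local_frames X r) : Prop :=
  [/\ forall x, open (fdom F x) /\ fdom F x x,
      forall x y, fdom F x y -> fmat F x y \in unitmx
    & forall x y z i j, fdom F x z -> fdom F y z ->
        smooth_funC (fun p => (invmx (fmat F x p) *m fmat F y p) i j) z].

Definition smooth_section (F : local_frames X r) (s : X -> 'cV[C]_r) (x : X) :
    Prop :=
  forall i, smooth_funC (fun y => (invmx (fmat F x y) *m s y) i ord0) x.

(* det of the bundle, i.e. the line bundle \Lambda^r: s_1 /\ ... /\ s_r in the
   fibre at x is represented by the determinant of the matrix (s_1 ... s_r). *)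
Definition det_frames (F : local_frames X r) : local_frames X 1 :=
  LocalFrames (fdom F) (fun x y => (\det (fmat F x y))%:M).

(* conjugate-linear on the left *)
Definition herm (h : 'M[C]_r) (s t : 'cV[C]_r) : C :=
  ((map_mx Num.conj s)^T *m h *m t) ord0 ord0.

Definition hermitian_metric (F : local_frames X r) (h : X -> 'M[C]_r) : Prop :=
  [/\ forall x s t, herm (h x) t s = Num.conj (herm (h x) s t),
      forall x s, s != 0 -> 0 < herm (h x) s s
    & forall x s t, smooth_section F s x -> smooth_section F t x ->
        smooth_funC (fun y => herm (h y) (s y) (t y)) x].

(* Column j of [nabla s x] is the derivative of s along the j-th coordinate
   vector of [chart_at x].  A connection is local, hence acts on sections that
   are smooth near x only; its values elsewhere are irrelevant. *)
Record connection (F : local_frames X r) := Connection {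
  nabla :> (X -> 'cV[C]_r) -> X -> 'M[C]_(r, n);
  nabla_add : forall s t x, smooth_section F s x -> smooth_section F t x ->
    nabla (fun y => s y + t y) x = nabla s x + nabla t x;
  nabla_leibniz : forall (f : X -> C) s x,
    smooth_funC f x -> smooth_section F s x ->
    nabla (fun y => f y *: s y) x = s x *m dfunC f x + f x *: nabla s x;
  nabla_local : forall s t x, smooth_section F s x -> smooth_section F t x ->
    (\forall y \near x, s y = t y) -> nabla s x = nabla t x;
  nabla_smooth : forall s x, smooth_section F s x ->
    forall j, smooth_section F
      (fun y => col j (nabla s y *m toC (cochange x y))) x }.

Definition hermitian_connection (F : local_frames X r) (h : X -> 'M[C]_r)
    (D : connection F) : Prop :=
  forall x s t, smooth_section F s x -> smooth_section F t x ->
  forall j, dfunC (fun y => herm (h y) (s y) (t y)) x ord0 j =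
    herm (h x) (col j (D s x)) (t x) + herm (h x) (s x) (col j (D t x)).

End Bundles.

(* A (s_1 /\ ... /\ s_r) = \sum_k s_1 /\ ... /\ D s_k /\ ... /\ s_r *)
Definition induces_on_det (R : realType) (n : nat)
    (X : oriented_manifold R n) (r : nat) (F : local_frames X r) (D : connection F)
    (A : connection (det_frames F)) : Prop :=
  forall x (s : 'I_r -> X -> 'cV[R[i]]_r),
  (forall k, smooth_section F (s k) x) ->
  forall j, A (fun y => (\det (\matrix_(a, k) s k y a ord0))%:M) x ord0 j =
    \sum_(k < r) \det (\matrix_(a, l)
       (if l == k then D (s k) x a j else s l x a ord0)).

(* A Hermitian bundle of rank 2^(n/2) with a Clifford action of T^*X (for
   this rank the Clifford modules W_x are automatically irreducible). *)
Record spinc_bundle (R : realType) (n : nat) (X : oriented_riemannian R n) :=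
  SpincBundle {
  frames : local_frames X (2 ^ n./2);
  frames_bundle : is_vector_bundle frames;
  metricW : X -> 'M[R[i]]_(2 ^ n./2);
  metricW_hermitian : hermitian_metric frames metricW;
  clif : X -> 'rV[R]_n -> 'M[R[i]]_(2 ^ n./2);
  clif_linear : forall x (a : R) u v,
    clif x (a *: u + v) = real_complex R a *: clif x u + clif x v;
  clif_relation : forall x u v,
    clif x u *m clif x v + clif x v *m clif x u =
    (real_complex R (- 2 * covector_dot x u v))%:M;
  clif_skew : forall x v s t,
    herm (metricW x) (clif x v *m s) t = - herm (metricW x) s (clif x v *m t);
  clif_smooth : forall x u s, smooth_covector u x -> smooth_section frames s x ->
    smooth_section frames (fun y => clif y (u y) *m s y) x }.

Section Dirac.
Variables (R : realType) (n : nat) (X : oriented_riemannian R n).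
Variable W : spinc_bundle X.
Notation C := R[i].
Notation N := (2 ^ n./2)%N.

Definition det_metric (x : X) : 'M[C]_1 := (\det (metricW W x))%:M.

(* The (unique) spin^c connection of the Hermitian connection A of det W: the
   Hermitian connection of W inducing A for which the Clifford multiplication
   is parallel, T^*X carrying the Levi-Civita connection. *)
Definition spinc_connection (A : connection (det_frames (frames W)))
    (D : connection (frames W)) : Prop :=
  [/\ hermitian_connection (metricW W) D,
      induces_on_det D A
    & forall x u s, smooth_covector u x -> smooth_section (frames W) s x ->
      forall j, col j (D (fun y => clif W y (u y) *m s y) x) =
        clif W x (LC_covector u x j) *m s x + clif W x (u x) *m col j (D s x)].

Definition dirac (D : connection (frames W)) (s : X -> 'cV[C]_N) (x : X) :
    'cV[C]_N :=
  \sum_(j < n) clif W x (delta_mx ord0 j) *m col j (D s x).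

(* c(b) = \sum_I b_I c(e^{i_1}) ... c(e^{i_p}) where b = \sum_I b_I e^I, hence
   b_I = <e^I, b>, in the orthonormal coframe e. *)
Definition clif_form (x : X) (e : 'M[R]_n) (b : extform C n) : 'M[C]_N :=
  \sum_(I : {set 'I_n})
    form_herm (metric x) (row_wedge (toC e) I) b *:
    foldr (fun i M => clif W x (row i e) *m M) 1%:M (enum I).

End Dirac.

(* The value at w is the v' with hV (f v) w = hU v v' for all v. *)
Definition adjoint (C : nzRingType) (U V : lmodType C) (hU : U -> U -> C)
    (hV : V -> V -> C) (f : U -> V) (w : V) : U :=
  xget 0 [set v' | forall v, hV (f v) w = hU v v'].

Section Symbols.
Variables (R : realType) (n : nat) (X : oriented_manifold R n).
Notation C := R[i].
Variables E F : lmodType C.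

(* sigma is the symbol of the differential operator D from sections of E to
   sections of F.  [smooth xi x] says that the section xi of E is smooth near
   x; as D is local, f and xi need only be smooth near x. *)
Definition is_symbol (smooth : (X -> E) -> X -> Prop)
    (D : (X -> E) -> X -> F) (sigma : X -> 'rV[R]_n -> E -> F) : Prop :=
  [/\ forall x u, linear (sigma x u),
      forall x (a : R) u v xi, sigma x (a *: u + v) xi =
        real_complex R a *: sigma x u xi + sigma x v xi
    & forall x (f : X -> R) xi, smooth_fun f x -> smooth xi x ->
        D (fun y => real_complex R (f y) *: xi y) x =
        sigma x (dfun f x) (xi x) + real_complex R (f x) *: D xi x].

Definition concentrating_pair (hE : X -> E -> E -> C) (hF : X -> F -> F -> C)
    (sigma : X -> 'rV[R]_n -> E -> F) (A : X -> E -> F) : Prop :=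
  forall x u, adjoint (hE x) (hF x) (A x) \o sigma x u =1
              adjoint (hE x) (hF x) (sigma x u) \o A x.

End Symbols.

Section SpinorForms.
Variables (R : realType) (n : nat) (X : oriented_riemannian R n).
Variable W : spinc_bundle X.
Notation C := R[i].
Notation spinor := 'cV[C]_(2 ^ n./2).
Notation spinor_form := (spinor * extform C n)%type.

Definition smooth_spinor_form (xi : X -> spinor_form) (x : X) : Prop :=
  smooth_section (frames W) (fun y => (xi y).1) x /\
  smooth_form (fun y => (xi y).2) x.

Definition spinor_form_herm (x : X) (a b : spinor_form) : C :=
  herm (metricW W x) a.1 b.1 + form_herm (metric x) a.2 b.2.

Definition dirac_form (D : connection (frames W)) (xi : X -> spinor_form)
    (x : X) : spinor_form :=
  (dirac D (fun y => (xi y).1) x,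
   form_d (fun y => (xi y).2) x + form_dstar (fun y => (xi y).2) x).

Definition Ppsi (e : X -> 'M[R]_n) (psi : X -> spinor) (x : X) (b : extform C n) :
    spinor :=
  clif_form W x (e x) b *m psi x.

Definition Apsi (e : X -> 'M[R]_n) (psi : X -> spinor) (x : X)
    (xi : spinor_form) : spinor_form :=
  (Ppsi e psi x xi.2,
   - adjoint (form_herm (metric x)) (herm (metricW W x)) (Ppsi e psi x) xi.1).

End SpinorForms.

(* Main.v *)
Require Import Defs.
From HB Require Import structures.
From mathcomp Require Import all_boot all_order all_algebra.
From mathcomp Require Import complex ring.
From mathcomp Require Import all_classical all_reals topology normedtype derive realfun.

Set Implicit Arguments.
Unset Strict Implicit.
Unset Printing Implicit Defensive.

Import Order.TTheory GRing.Theory Num.Theory numFieldNormedType.Exports.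

(** Write c^(u) b = u /\ b - iota_u b for the action of a real covector u on
    complex forms, iota_u being the interior product with the vector metrically
    dual to u.  The symbol of the direct sum of D_A and d + d^* is
    sigma(u) = (c(u), c^(u)), and everything follows from three facts:
    - c(u) and c^(u) are skew-adjoint, hence so is sigma(u), and A_psi is
      skew-adjoint by its very shape;
    - c(c^(u) b) = c(u) c(b), so P_psi intertwines c^(u) and c(u), and then, by
      skewness, P_psi^* intertwines c(u) and c^(u);
    - hence sigma(u) and A_psi commute, and
      A_psi^* sigma(u) = - A_psi sigma(u) = - sigma(u) A_psi
                       = sigma(u)^* A_psi.

    The algebra lives on coordinate forms.  The interior product iprod obeys
    Cartan's relation (iprod_wedge), and the map induced on forms by a matrix is
    a morphism for the wedge product (form_map_wedge), has the map induced by
    the transpose as its transpose (form_map_adj) and intertwines interior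
    products (iprod_form_map).  With G the inverse of the Gram matrix, the
    metric on forms is the flat pairing twisted by form_map G, the Hodge star is
    sqrt(det g) times the flat star composed with form_map G, and the Clifford
    action of a form is the flat one applied to its image under the inverse of
    the coframe; all metric statements thus reduce to identities between signs.
    Identities between linear maps on forms that behave well under wedge
    products are checked at the form 1 only (extform_ind).

    That the symbol of d^* is minus the interior product (hodge_wedge_hodge)
    uses two properties of the star: it exchanges exterior and interior products
    up to sign (flat_star_wedge, flat_star_iprod), and its square is the sign
    (-1)^(p (n - p)) in degree p (flat_star_twice), where det g and the
    determinant of G on the top form (row_wedge_det) cancel.

    Analytically, the Leibniz rules need the product rule only; the coefficients
    of the Hodge star are differentiable because the metric is smooth and
    det g > 0.  A symbol is unique because functions and sections with
    prescribed df and value at a point exist, so the statement about an arbitrary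
    symbol reduces to the explicit one. *)

(** * Wedge and interior products *)

Section ExteriorAlgebra.
Local Open Scope ring_scope.
Variables (C : comNzRingType) (n : nat).
Implicit Types (b c : extform C n) (u v w : 'rV[C]_n) (K L : {set 'I_n}).
Implicit Types (A B : 'M[C]_n).

Lemma extformP b c : (forall K, b K = c K) -> b = c.
Proof. by move=> bc; apply/ffunP. Qed.

Lemma extform0E K : (0 : extform C n) K = 0.
Proof. by rewrite ffunE. Qed.

Lemma extformDE b c K : (b + c) K = b K + c K.
Proof. by rewrite ffunE. Qed.

Lemma extformNE b K : (- b) K = - b K.
Proof. by rewrite ffunE. Qed.

Lemma extformZE (a : C) b K : (a *: b) K = a * b K.
Proof. by rewrite ffunE. Qed.

Lemma extform_sumE (I : Type) (r : seq I) (P : pred I) (F : I -> extform C n) K :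
  (\sum_(i <- r | P i) F i) K = \sum_(i <- r | P i) F i K.
Proof. by rewrite sum_ffunE. Qed.

(** The basis form dx^I; its coefficient on dx^J is 1 for J = I and 0 otherwise. *)
Definition dform (I : {set 'I_n}) : extform C n := [ffun J => (J == I)%:R].

Lemma dformE I J : dform I J = (J == I)%:R.
Proof. by rewrite ffunE. Qed.

Lemma dform_set0 : dform finset.set0 = form_one C n.
Proof. by apply: extformP => K; rewrite !ffunE; case: eqP. Qed.

Lemma extform_basis b : b = \sum_I b I *: dform I.
Proof.
apply: extformP => K; rewrite extform_sumE (bigD1 K) //= extformZE dformE eqxx.
rewrite mulr1 big1 ?addr0 // => I neIK.
by rewrite extformZE dformE eq_sym (negPf neIK) mulr0.
Qed.

Lemma wedgeE v b K :
  wedge v b K = \sum_(k in K) ins_sign C k K * v ord0 k * b (K :\ k)%SET.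
Proof. by rewrite ffunE. Qed.

(** Interior product with the vector of components v.  No metric is involved:
    the coefficients of v are those of a vector in the basis dual to the dx^i.
    The sign is that of k in K together with k, so that iprod v is the transpose
    of wedge v for the pairing in which the dx^I are orthonormal. *)
Definition iprod v b : extform C n :=
  [ffun K : {set 'I_n} => \sum_(k | k \notin K)
     ins_sign C k (k |: K)%SET * v ord0 k * b (k |: K)%SET].

Lemma iprodE v b K : iprod v b K =
  \sum_(k | k \notin K) ins_sign C k (k |: K)%SET * v ord0 k * b (k |: K)%SET.
Proof. by rewrite ffunE. Qed.

Lemma wedge_linear v : linear (wedge v).
Proof.
move=> a b c; apply: extformP => K; rewrite extformDE extformZE !wedgeE.
rewrite mulr_sumr -big_split /=; apply: eq_bigr => k _.
by rewrite extformDE extformZE mulrDr mulrCA.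
Qed.
HB.instance Definition _ v :=
  GRing.isLinear.Build C (extform C n) (extform C n) _ (wedge v)
    (wedge_linear v).

Lemma iprod_linear v : linear (iprod v).
Proof.
move=> a b c; apply: extformP => K; rewrite extformDE extformZE !iprodE.
rewrite mulr_sumr -big_split /=; apply: eq_bigr => k _.
by rewrite extformDE extformZE mulrDr mulrCA.
Qed.
HB.instance Definition _ v :=
  GRing.isLinear.Build C (extform C n) (extform C n) _ (iprod v)
    (iprod_linear v).

Lemma wedge_linearl b : linear (fun v : 'rV[C]_n => wedge v b).
Proof.
move=> a v w; apply: extformP => K; rewrite extformDE extformZE !wedgeE.
rewrite mulr_sumr -big_split /=; apply: eq_bigr => k _.
by rewrite !mxE mulrDr mulrDl mulrCA !mulrA.
Qed.

Lemma iprod_linearl b : linear (fun v : 'rV[C]_n => iprod v b).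
Proof.
move=> a v w; apply: extformP => K; rewrite extformDE extformZE !iprodE.
rewrite mulr_sumr -big_split /=; apply: eq_bigr => k _.
by rewrite !mxE mulrDr mulrDl mulrCA !mulrA.
Qed.

(** A function of row vectors is determined by the basis vectors when it is
    linear; stated for an unbundled linear function. *)
Lemma linearl_sum (V : lmodType C) (f : 'rV[C]_n -> V) :
  linear f -> forall v, f v = \sum_k v ord0 k *: f (delta_mx ord0 k).
Proof.
move=> lin v; pose lf := GRing.isLinear.Build C _ _ _ f lin.
pose g : {linear 'rV[C]_n -> V} := HB.pack f lf.
rewrite -[LHS]/(g v) {1}(row_sum_delta v) (linear_sum g); apply: eq_bigr => k _.
by rewrite linearZ.
Qed.

Lemma wedge_sum v b :
  wedge v b = \sum_k v ord0 k *: wedge (delta_mx ord0 k) b.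
Proof. exact: (linearl_sum (wedge_linearl b)). Qed.

Lemma iprod_sum v b :
  iprod v b = \sum_k v ord0 k *: iprod (delta_mx ord0 k) b.
Proof. exact: (linearl_sum (iprod_linearl b)). Qed.

Lemma wedge_deltaE k b K : wedge (delta_mx ord0 k) b K =
  if k \in K then ins_sign C k K * b (K :\ k)%SET else 0.
Proof.
rewrite wedgeE; case: ifPn => kK.
  rewrite (bigD1 k) //= mxE !eqxx mulr1 big1 ?addr0 // => j /andP[_ jk].
  by rewrite mxE (negPf jk) andbF mulr0 mul0r.
rewrite big1 // => j jK; rewrite mxE eqxx /=; case: eqP => [jk|_].
  by rewrite -jk jK in kK.
by rewrite mulr0 mul0r.
Qed.

Lemma iprod_deltaE k b K : iprod (delta_mx ord0 k) b K =
  if k \in K then 0 else ins_sign C k (k |: K)%SET * b (k |: K)%SET.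
Proof.
rewrite iprodE; case: ifPn => kK.
  rewrite big1 // => j jK; rewrite mxE eqxx /=; case: eqP => [jk|_].
    by rewrite jk kK in jK.
  by rewrite mulr0 mul0r.
rewrite (bigD1 k) //= mxE !eqxx mulr1 big1 ?addr0 // => j /andP[_ jk].
by rewrite mxE (negPf jk) andbF mulr0 mul0r.
Qed.

Lemma ins_signD1 j k K : j \in K ->
  ins_sign C k K = (-1) ^+ (j < k)%N * ins_sign C k (K :\ j)%SET.
Proof.
move=> jK; rewrite /ins_sign (cardsD1 j) inE jK /= exprD.
congr (_ * (-1) ^+ #|pred_of_set _|); apply/setP => i.
by rewrite !inE andbA.
Qed.

Lemma ins_signU1 j k K : j \notin K ->
  ins_sign C k (j |: K)%SET = (-1) ^+ (j < k)%N * ins_sign C k K.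
Proof. by move=> jK; rewrite (@ins_signD1 j) ?setU11 // setU1K. Qed.

Lemma ins_signK k K (x : C) : ins_sign C k K * (ins_sign C k K * x) = x.
Proof. by rewrite mulrA /ins_sign -expr2 sqrr_sign mul1r. Qed.

Lemma wedge_deltaC j k b : j != k ->
  wedge (delta_mx ord0 j) (wedge (delta_mx ord0 k) b) =
  - wedge (delta_mx ord0 k) (wedge (delta_mx ord0 j) b).
Proof.
wlog lt_jk : j k / (j < k)%N => [hw|] jk.
  have [lt_jk|lt_kj|/val_inj eq_jk] := ltngtP j k; first exact: hw.
    by rewrite (hw k j) ?opprK // eq_sym.
  by rewrite eq_jk eqxx in jk.
apply: extformP => K; rewrite extformNE !wedge_deltaE !inE jk eq_sym jk /=.
case: (boolP (j \in K)) => jK; case: (boolP (k \in K)) => kK //=;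
  rewrite ?mulr0 ?oppr0 //.
rewrite (@ins_signD1 k j K) // (@ins_signD1 j k K) // lt_jk ltnNge (ltnW lt_jk) /=.
rewrite expr0 expr1 mul1r (finset.setDDl K [set j]%SET) (finset.setDDl K [set k]%SET).
by rewrite (finset.setUC [set k]%SET) mulN1r mulNr opprK mulrCA.
Qed.

Lemma wedge_deltaK k b :
  wedge (delta_mx ord0 k) (wedge (delta_mx ord0 k) b) = 0.
Proof.
apply: extformP => K; rewrite extform0E !wedge_deltaE !inE eqxx /=.
by case: ifP; rewrite ?mulr0.
Qed.

Lemma iprod_wedge_delta j k b :
  iprod (delta_mx ord0 j) (wedge (delta_mx ord0 k) b) =
  (j == k)%:R *: b - wedge (delta_mx ord0 k) (iprod (delta_mx ord0 j) b).
Proof.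
apply: extformP => K; rewrite extformDE extformNE extformZE.
rewrite !(wedge_deltaE, iprod_deltaE) !inE.
have [<-|jk] := eqVneq j k.
  rewrite mulr1n mul1r /=; case: (boolP (j \in K)) => jK.
    by rewrite finset.setD1K // ins_signK subrr.
  by rewrite subr0 ins_signK setU1K.
rewrite mulr0n mul0r add0r /=.
case: (boolP (j \in K)) => jK; case: (boolP (k \in K)) => kK /=;
  rewrite ?mulr0 ?oppr0 //.
have kjK : (k \in j |: K)%SET by rewrite !inE kK orbT.
have EK : ((j |: K) :\ k = j |: (K :\ k))%SET.
  apply/setP => i; rewrite !inE; case: eqP => // ->.
  by rewrite eq_sym (negPf jk).
rewrite -EK (@ins_signU1 j k K) // (@ins_signD1 k j (j |: K)%SET) //.
have [lt_jk|lt_kj|/val_inj eq_jk] := ltngtP j k.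
- by rewrite expr0 expr1 mul1r mulN1r mulNr !mulrN mulrCA.
- by rewrite expr0 expr1 mul1r mulN1r mulNr mulrCA.
- by rewrite eq_jk eqxx in jk.
Qed.

(** Cartan's relation: iprod is an antiderivation. *)
Lemma iprod_wedge v w b :
  iprod v (wedge w b) = (v *m w^T) ord0 ord0 *: b - wedge w (iprod v b).
Proof.
rewrite iprod_sum (iprod_sum v b) linear_sum mxE scaler_suml -sumrB.
apply: eq_bigr => j _; rewrite mxE linearZ /= -scalerA -scalerBr; congr (_ *: _).
rewrite (wedge_sum w b) linear_sum /= (wedge_sum w (iprod _ b)).
transitivity (\sum_i (w ord0 i * (j == i)%:R) *: b -
  \sum_k w ord0 k *: wedge (delta_mx ord0 k) (iprod (delta_mx ord0 j) b)).
  rewrite -sumrB; apply: eq_bigr => k _.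
  by rewrite linearZ /= iprod_wedge_delta scalerBr scalerA.
congr (_ - _); rewrite (bigD1 j) //= eqxx mulr1 big1 ?addr0 // => i ij.
by rewrite eq_sym (negPf ij) mulr0 scale0r.
Qed.

Lemma wedgeC v w b : wedge v (wedge w b) = - wedge w (wedge v b).
Proof.
rewrite (wedge_sum v) (wedge_sum v b) linear_sum -sumrN; apply: eq_bigr => j _.
rewrite linearZ /= -scalerN; congr (_ *: _).
rewrite (wedge_sum w b) linear_sum /= (wedge_sum w) -sumrN; apply: eq_bigr => k _.
rewrite linearZ /= -scalerN; congr (_ *: _).
have [->|jk] := eqVneq j k; first by rewrite wedge_deltaK oppr0.
exact: wedge_deltaC.
Qed.

Lemma wedge_nilp v b : wedge v (wedge v b) = 0.
Proof.
(* an argument through v /\ v = - v /\ v would need 2 to be regular in C *)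
rewrite (wedge_sum v); under eq_bigr => j _ do
  rewrite (wedge_sum v b) linear_sum scaler_sumr /=.
(* the terms (j, k) and (k, j) cancel *)
have wC (F : 'I_n -> 'I_n -> extform C n) : (forall j k, F j k = - F k j) ->
    (forall j, F j j = 0) -> \sum_j \sum_k F j k = 0.
  move=> antiF F0.
  have -> : \sum_j \sum_k F j k =
      \sum_(j < n) \sum_(k < n | (k < j)%N) F j k +
      \sum_(j < n) \sum_(k < n | (j < k)%N) F j k.
    rewrite -big_split /=; apply: eq_bigr => j _.
    rewrite (bigID (fun k : 'I_n => (k < j)%N)) /=; congr (_ + _).
    rewrite (bigD1 j) ?ltnn //= F0 add0r; apply: eq_bigl => k.
    by rewrite -leqNgt ltn_neqAle andbC eq_sym.
  rewrite (exchange_big_dep xpredT) //= -big_split /= big1 // => k _.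
  by rewrite -big_split /= big1 // => j _; rewrite antiF addNr.
apply: wC => [j k|j]; last by rewrite linearZ /= wedge_deltaK !scaler0.
by rewrite !linearZ /= wedgeC !scalerN; congr (- _); rewrite !scalerA mulrC.
Qed.

Lemma iprod_one v : iprod v (form_one C n) = 0.
Proof.
apply: extformP => K; rewrite iprodE extform0E big1 // => k _.
rewrite ffunE; case: eqP => [E|_]; last by rewrite mulr0.
by have := setU11 k K; rewrite E inE.
Qed.

(** The basis forms are iterated wedge products of the dx^k, in any order. *)
Lemma wedge_delta_dform k L : k \notin L ->
  dform (k |: L)%SET = ins_sign C k (k |: L)%SET *: wedge (delta_mx ord0 k) (dform L).
Proof.
move=> kL; apply: extformP => K; rewrite extformZE wedge_deltaE !dformE.
case: (eqVneq K (k |: L)%SET) => [->|neK].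
  by rewrite setU11 setU1K // eqxx mulr1 /ins_sign -expr2 sqrr_sign.
case: ifP => kK; last by rewrite mulr0.
case: eqP => [E|_]; last by rewrite !mulr0.
by rewrite -E finset.setD1K // eqxx in neK.
Qed.

Lemma wedge_delta_dform0 k L : k \in L ->
  wedge (delta_mx ord0 k) (dform L) = 0.
Proof.
move=> kL; apply: extformP => K; rewrite extform0E wedge_deltaE dformE.
case: ifP => // kK; case: eqP => [E|_]; last by rewrite mulr0.
by move: kL; rewrite -E !inE eqxx.
Qed.

Lemma iprod_delta_dform0 k L : k \notin L ->
  iprod (delta_mx ord0 k) (dform L) = 0.
Proof.
move=> kL; apply: extformP => K; rewrite extform0E iprod_deltaE dformE.
case: ifP => // kK; case: eqP => [E|_]; last by rewrite mulr0.
by move: kL; rewrite -E setU11.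
Qed.

Lemma iprod_delta_dform k L : k \in L ->
  iprod (delta_mx ord0 k) (dform L) = ins_sign C k L *: dform (L :\ k)%SET.
Proof.
move=> kL; apply: extformP => K; rewrite extformZE iprod_deltaE !dformE.
case: (eqVneq K (L :\ k)%SET) => [->|neK].
  by rewrite !inE eqxx /= finset.setD1K // eqxx.
case: ifP => kK; first by rewrite mulr0.
case: eqP => [E|_]; last by rewrite !mulr0.
by rewrite -E setU1K ?kK // eqxx in neK.
Qed.

(** Forms are generated by 1 under linear combinations and products with the
    dx^k: a linear identity that is stable under these products holds as soon
    as it holds at 1. *)
Lemma extform_ind (P : extform C n -> Prop) :
  P (form_one C n) ->
  (forall a b c, P b -> P c -> P (a *: b + c)) ->
  (forall k b, P b -> P (wedge (delta_mx ord0 k) b)) ->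
  forall b, P b.
Proof.
move=> P1 PD PW b.
have P0 : P 0.
  by have := PD (-1) _ _ P1 P1; rewrite scaleN1r addNr.
have PI I : P (dform I).
  elim: {I}#|I| {-2}I (erefl #|I|) => [|m IHm] I cI.
    by rewrite (cards0_eq cI) dform_set0.
  have /card_gt0P[k kI] : (0 < #|I|)%N by rewrite cI.
  rewrite -(finset.setD1K kI) wedge_delta_dform ?inE ?eqxx //.
  rewrite -[_ *: _]addr0; apply: PD => //; apply: PW; apply: IHm.
  by move: cI; rewrite (cardsD1 k) kI => -[].
rewrite [b]extform_basis; elim/big_rec: _ => // I c _ Pc.
exact: PD.
Qed.

Lemma dform_ext (V : lmodType C) (f g : {linear extform C n -> V}) :
  (forall I, f (dform I) = g (dform I)) -> f =1 g.
Proof.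
move=> fg b; rewrite [b]extform_basis !linear_sum; apply: eq_bigr => I _.
by rewrite !linearZ fg.
Qed.

(** * Forms under linear changes of coframe *)

(** Monomials x_{i_1} (x_{i_2} (... x_{i_p} x0)) in anticommuting operators,
    i_1 < ... < i_p being the elements of K: any factor can be moved to the
    front. *)
Lemma foldr_enum_anticomm (V : lmodType C) (f : 'I_n -> V -> V) (x0 : V) k K :
  (forall i (a : C) x, f i (a *: x) = a *: f i x) ->
  (forall i j x, i != j -> f i (f j x) = - f j (f i x)) -> k \in K ->
  foldr f x0 (enum K) = ins_sign C k K *: f k (foldr f x0 (enum (K :\ k)%SET)).
Proof.
move=> fZ fC kK.
(* the enumeration of the ordinals is increasing, hence split at k into the
   elements below k and those above k *)
have [s1 [s2 [Ee s1k s2k]]] : exists s1 s2 : seq 'I_n,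
    [/\ enum 'I_n = s1 ++ k :: s2, all (fun i : 'I_n => (i < k)%N) s1
      & all (fun i : 'I_n => (k < i)%N) s2].
  have srt : pairwise (fun i j : 'I_n => (i < j)%N) (enum 'I_n).
    have := iota_ltn_sorted 0 n; rewrite -val_enum_ord.
    by rewrite (sorted_pairwise ltn_trans) pairwise_map.
  case/splitPr: (mem_enum 'I_n k) srt => s1 s2.
  rewrite pairwise_cat /= => /and3P[/allrelP H _ /andP[Hk _]].
  exists s1, s2; split => //.
  by apply/allP => i si; apply: H => //; rewrite mem_head.
have Eenum (L : {set 'I_n}) : enum L = [seq i <- enum 'I_n | i \in L].
  by rewrite enumT.
have EK : enum K = [seq i <- s1 | i \in K] ++ k :: [seq i <- s2 | i \in K].
  by rewrite Eenum Ee filter_cat /= kK.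
have EKk : enum (K :\ k)%SET =
    [seq i <- s1 | i \in K] ++ [seq i <- s2 | i \in K].
  rewrite Eenum Ee filter_cat /= !inE eqxx /=; congr (_ ++ _).
    apply: eq_in_filter => i /(allP s1k) ik; rewrite !inE; case: eqP => // Ei.
    by rewrite Ei ltnn in ik.
  apply: eq_in_filter => i /(allP s2k) ik; rewrite !inE; case: eqP => // Ei.
  by rewrite Ei ltnn in ik.
have -> : ins_sign C k K = (-1) ^+ size [seq i <- s1 | i \in K].
  rewrite /ins_sign cardE Eenum Ee filter_cat /= !inE ltnn andbF size_cat.
  have -> : [seq i <- s2 | i \in [set j in K | (j < k)%N]%SET] = [::].
    apply/eqP; rewrite -[_ == _]negbK -has_filter; apply/hasPn => i.
    by move=> /(allP s2k) ik; rewrite !inE ltnNge (ltnW ik) andbF.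
  rewrite addn0; congr (_ ^+ size _); apply: eq_in_filter => i /(allP s1k) ik.
  by rewrite !inE ik andbT.
rewrite EK EKk !foldr_cat /=; move: (foldr f x0 _) => x.
have : all (fun i : 'I_n => (i < k)%N) [seq i <- s1 | i \in K].
  by apply/allP => i; rewrite mem_filter => /andP[_ /(allP s1k)].
elim: [seq i <- s1 | i \in K] => [|i s IHs] /=; first by rewrite scale1r.
move=> /andP[ik /IHs ->]; rewrite fZ fC; last by rewrite neq_ltn ik.
by rewrite exprS mulN1r scaleNr scalerN.
Qed.

Lemma form_map_linear A : linear (form_map A).
Proof.
move=> a b c; rewrite /form_map scaler_sumr -big_split /=.
by apply: eq_bigr => I _; rewrite extformDE extformZE scalerDl scalerA.
Qed.
HB.instance Definition _ A :=
  GRing.isLinear.Build C (extform C n) (extform C n) _ (form_map A)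
    (form_map_linear A).

Lemma form_map_dform A I : form_map A (dform I) = row_wedge A I.
Proof.
rewrite /form_map (bigD1 I) //= dformE eqxx scale1r big1 ?addr0 // => J neJI.
by rewrite dformE (negPf neJI) scale0r.
Qed.

Lemma row_wedge0 A : row_wedge A finset.set0 = form_one C n.
Proof. by rewrite /row_wedge enum_set0. Qed.

Lemma row_wedgeD1 A k K : k \in K ->
  row_wedge A K = ins_sign C k K *: wedge (row k A) (row_wedge A (K :\ k)%SET).
Proof.
move=> kK; rewrite /row_wedge (@foldr_enum_anticomm _ _ _ k) // => [i a x|i j x _].
  by rewrite linearZ.
exact: wedgeC.
Qed.

Lemma form_map_one A : form_map A (form_one C n) = form_one C n.
Proof. by rewrite -dform_set0 form_map_dform row_wedge0 dform_set0. Qed.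

Lemma form_map_wedge_delta A k b :
  form_map A (wedge (delta_mx ord0 k) b) = wedge (row k A) (form_map A b).
Proof.
apply: (@dform_ext _ (form_map A \o wedge _) (wedge _ \o form_map A)) => I /=.
rewrite form_map_dform.
have [kI|kI] := boolP (k \in I).
  rewrite wedge_delta_dform0 // linear0 (row_wedgeD1 _ kI) linearZ /=.
  by rewrite wedge_nilp scaler0.
have := form_map_dform A (k |: I)%SET.
rewrite wedge_delta_dform // (@row_wedgeD1 A k) ?setU11 // setU1K // linearZ /=.
move/(congr1 (fun x => ins_sign C k (k |: I)%SET *: x)).
by rewrite !scalerA /ins_sign -expr2 sqrr_sign !scale1r.
Qed.

(** form_map A is a morphism of algebras. *)
Lemma form_map_wedge A v b :
  form_map A (wedge v b) = wedge (v *m A) (form_map A b).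
Proof.
have lin : linear (fun w : 'rV[C]_n => wedge (w *m A) (form_map A b)).
  by move=> a w1 w2; rewrite mulmxDl -scalemxAl wedge_linearl.
rewrite (linearl_sum lin) wedge_sum linear_sum; apply: eq_bigr => k _.
by rewrite linearZ /= form_map_wedge_delta rowE.
Qed.

Lemma form_map_comp A B b : form_map A (form_map B b) = form_map (B *m A) b.
Proof.
elim/extform_ind: b => [|a b c Hb Hc|k b Hb]; first by rewrite !form_map_one.
  by rewrite !linearP /= Hb Hc.
by rewrite !form_map_wedge_delta form_map_wedge Hb row_mul.
Qed.

Lemma form_map1 b : form_map 1%:M b = b.
Proof.
elim/extform_ind: b => [|a b c Hb Hc|k b Hb]; first by rewrite form_map_one.
  by rewrite linearP /= Hb Hc.
by rewrite form_map_wedge_delta Hb row1.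
Qed.

(** Naturality of the interior product: vectors are pulled back by the
    transpose of the matrix that maps covectors. *)
Lemma iprod_form_map v A b :
  iprod v (form_map A b) = form_map A (iprod (v *m A^T) b).
Proof.
elim/extform_ind: b => [|a b c Hb Hc|k b Hb].
- by rewrite form_map_one !iprod_one linear0.
- by rewrite !linearP /= Hb Hc.
rewrite form_map_wedge_delta !iprod_wedge Hb linearB linearZ /=.
rewrite form_map_wedge_delta; congr (_ *: _ - _).
by rewrite rowE trmx_mul mulmxA.
Qed.

(** The bilinear pairing for which the dx^I are orthonormal. *)
Definition form_dot b c : C := \sum_I b I * c I.

Lemma form_dotDl a b c d : form_dot (a *: b + c) d = a * form_dot b d + form_dot c d.
Proof.
rewrite /form_dot mulr_sumr -big_split /=; apply: eq_bigr => I _.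
by rewrite extformDE extformZE mulrDl mulrA.
Qed.

Lemma form_dotC b c : form_dot b c = form_dot c b.
Proof. by apply: eq_bigr => I _; rewrite mulrC. Qed.

Lemma form_dotDr a b c d : form_dot d (a *: b + c) = a * form_dot d b + form_dot d c.
Proof. by rewrite form_dotC form_dotDl !(form_dotC d). Qed.

Lemma form_dotZl a b c : form_dot (a *: b) c = a * form_dot b c.
Proof.
rewrite /form_dot mulr_sumr; apply: eq_bigr => I _.
by rewrite extformZE mulrA.
Qed.

Lemma form_dot_dform I b : form_dot (dform I) b = b I.
Proof.
rewrite /form_dot (bigD1 I) //= dformE eqxx mul1r big1 ?addr0 // => J neJI.
by rewrite dformE (negPf neJI) mul0r.
Qed.

Lemma form_dot_wedge_delta k b c :
  form_dot (wedge (delta_mx ord0 k) b) c =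
  form_dot b (iprod (delta_mx ord0 k) c).
Proof.
rewrite /form_dot (bigID (fun I : {set 'I_n} => k \in I)) /=.
rewrite [X in _ + X]big1 => [|I /negPf kI]; last first.
  by rewrite wedge_deltaE kI mul0r.
rewrite [RHS](bigID (fun I : {set 'I_n} => k \notin I)) /=.
rewrite [X in _ = _ + X]big1 => [|I]; last first.
  by rewrite negbK iprod_deltaE => ->; rewrite mulr0.
rewrite !addr0 (reindex_onto (fun I => k |: I)%SET (fun I => I :\ k)%SET) /=.
  apply: eq_big => [I|I].
    rewrite setU11 /=; apply/eqP/idP => [<-|kI]; first by rewrite !inE eqxx.
    by rewrite setU1K.
  move=> /andP[_ /eqP EI]; have kI : k \notin I by rewrite -EI !inE eqxx.
  rewrite wedge_deltaE iprod_deltaE setU11 (negPf kI) EI.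
  by rewrite mulrA [b I * _]mulrC.
by move=> I kI; rewrite finset.setD1K.
Qed.

Lemma form_dot_suml (I : finType) (F : I -> extform C n) c :
  form_dot (\sum_i F i) c = \sum_i form_dot (F i) c.
Proof.
rewrite /form_dot exchange_big /=; apply: eq_bigr => K _.
by rewrite extform_sumE mulr_suml.
Qed.

Lemma form_dot_wedge v b c : form_dot (wedge v b) c = form_dot b (iprod v c).
Proof.
rewrite wedge_sum iprod_sum form_dot_suml form_dotC form_dot_suml.
apply: eq_bigr => k _; rewrite !form_dotZl form_dot_wedge_delta.
by rewrite [in RHS]form_dotC.
Qed.

Lemma form_map_set0 A b : form_map A b finset.set0 = b finset.set0.
Proof.
elim/extform_ind: b => [|a b c Hb Hc|k b Hb]; first by rewrite form_map_one.
  by rewrite linearP !extformDE !extformZE Hb Hc.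
by rewrite form_map_wedge_delta !wedgeE !big_set0.
Qed.

(** Minors of the transpose: the flat transpose of form_map A is form_map A^T.
    In particular form_map G is symmetric when G is. *)
Lemma form_map_adj A b c :
  form_dot (form_map A b) c = form_dot b (form_map A^T c).
Proof.
elim/extform_ind: b c => [|a b d Hb Hd|k b Hb] c.
- by rewrite form_map_one -dform_set0 !form_dot_dform form_map_set0.
- by rewrite linearP !form_dotDl Hb Hd.
rewrite form_map_wedge_delta !form_dot_wedge Hb iprod_form_map trmxK.
by rewrite rowE.
Qed.

(** Multiplies the component of degree p by h p. *)
Definition degscale (h : nat -> C) b : extform C n :=
  [ffun I : {set 'I_n} => h #|I| * b I].

Lemma degscaleE h b I : degscale h b I = h #|I| * b I.
Proof. by rewrite ffunE. Qed.

Lemma degscale_linear h : linear (degscale h).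
Proof.
move=> a b c; apply: extformP => K.
by rewrite extformDE extformZE !degscaleE extformDE extformZE mulrDr mulrCA.
Qed.
HB.instance Definition _ h :=
  GRing.isLinear.Build C (extform C n) (extform C n) _ (degscale h)
    (degscale_linear h).

Lemma degscale_one h : degscale h (form_one C n) = h 0%N *: form_one C n.
Proof.
apply: extformP => K; rewrite degscaleE extformZE ffunE.
by case: eqP => [->|_]; rewrite ?cards0 ?mulr0.
Qed.

Lemma degscale_wedge h v b :
  degscale h (wedge v b) = wedge v (degscale (h \o succn) b).
Proof.
apply: extformP => K; rewrite degscaleE !wedgeE mulr_sumr.
apply: eq_bigr => k kK; rewrite degscaleE (cardsD1 k) kK /= add1n.
by rewrite mulrCA.
Qed.

Lemma degscale_comp h1 h2 b :
  degscale h1 (degscale h2 b) = degscale (fun p => h1 p * h2 p) b.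
Proof. by apply: extformP => K; rewrite !degscaleE mulrA. Qed.

Lemma degscale_form_map h A b :
  degscale h (form_map A b) = form_map A (degscale h b).
Proof.
elim/extform_ind: b h => [|a b c Hb Hc|k b Hb] h.
- by rewrite form_map_one degscale_one linearZ /= form_map_one.
- by rewrite !linearP /= Hb Hc.
- by rewrite form_map_wedge_delta !degscale_wedge Hb form_map_wedge_delta.
Qed.

(** * The flat Hodge star *)

(** The top form is an eigenvector of form_map A.  The other coefficients vanish
    since form_map A commutes with the projection to degree n. *)
Lemma row_wedge_top A :
  form_map A (dform [set: 'I_n]%SET) = row_wedge A [set: 'I_n]%SET [set: 'I_n]%SET *: dform [set: 'I_n]%SET.
Proof.
apply: extformP => K; rewrite extformZE dformE form_map_dform.
have [->|neK] := eqVneq K [set: 'I_n]%SET; first by rewrite mulr1.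
pose h p : C := (p == n)%:R.
have -> : row_wedge A [set: 'I_n]%SET = degscale h (row_wedge A [set: 'I_n]%SET).
  rewrite -form_map_dform degscale_form_map; congr (form_map A _).
  apply: extformP => L; rewrite degscaleE dformE.
  by case: eqP => [->|_]; rewrite ?mulr0 // /h cardsT card_ord eqxx mulr1.
rewrite degscaleE /h; case: eqP => [cK|_]; last by rewrite mul0r mulr0.
case/eqP: neK; apply/eqP; rewrite eqEcard finset.subsetT cardsT card_ord cK.
by rewrite leqnn.
Qed.

(** Hodge star of the metric for which the dx^i are orthonormal. *)
Definition flat_star c : extform C n :=
  [ffun K : {set 'I_n} => shuffle_sign C (~: K)%SET K * c (~: K)%SET].

Lemma flat_starE c K :
  flat_star c K = shuffle_sign C (~: K)%SET K * c (~: K)%SET.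
Proof. by rewrite ffunE. Qed.

Lemma flat_star_linear : linear flat_star.
Proof.
move=> a b c; apply: extformP => K.
by rewrite extformDE extformZE !flat_starE extformDE extformZE mulrDr mulrCA.
Qed.
HB.instance Definition _ :=
  GRing.isLinear.Build C (extform C n) (extform C n) _ flat_star
    flat_star_linear.

Lemma shuffle_sign0l K : shuffle_sign C finset.set0 K = 1.
Proof.
rewrite /shuffle_sign (_ : [set p | _]%SET = finset.set0) ?cards0 //.
by apply/setP => p; rewrite !inE.
Qed.

Lemma shuffle_sign0r K : shuffle_sign C K finset.set0 = 1.
Proof.
rewrite /shuffle_sign (_ : [set p | _]%SET = finset.set0) ?cards0 //.
by apply/setP => p; rewrite !inE andbF.
Qed.

Lemma flat_star_one : flat_star (form_one C n) = dform [set: 'I_n]%SET.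
Proof.
apply: extformP => K; rewrite flat_starE dformE ffunE -finset.setCT (inj_eq (@finset.setC_inj _)).
by case: eqP => [->|_]; rewrite ?mulr0 // mulr1 finset.setCT shuffle_sign0l.
Qed.

Lemma flat_star_top : flat_star (dform [set: 'I_n]%SET) = form_one C n.
Proof.
apply: extformP => K; rewrite flat_starE dformE ffunE -finset.setC0 (inj_eq (@finset.setC_inj _)).
by case: eqP => [->|_]; rewrite ?mulr0 // mulr1 shuffle_sign0r.
Qed.

Lemma shuffle_signU1l k K L : k \notin K ->
  shuffle_sign C (k |: K)%SET L = ins_sign C k L * shuffle_sign C K L.
Proof.
move=> kK; rewrite /shuffle_sign /ins_sign -exprD; congr (_ ^+ _).
have inj : injective (fun j : 'I_n => (k, j)) by move=> i j [].
rewrite -(card_imset _ inj) -cardsUI [X in (_ = #|pred_of_set X| + _)%N](_ : _ =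
  [set p | [&& p.1 \in (k |: K)%SET, p.2 \in L & (p.2 < p.1)%N]]%SET).
  rewrite [X in (_ + #|pred_of_set X|)%N](_ : _ = finset.set0) ?cards0 ?addn0 //.
  apply/setP => -[i j]; rewrite !inE /=; apply/negbTE; apply/negP.
  case/andP => /imsetP[l _ [-> _]]; by rewrite (negPf kK).
apply/setP => -[i j]; rewrite !inE /=.
have [->|neik] := eqVneq i k.
  rewrite (negPf kK) /= orbF; apply/imsetP/andP => [[l + [->]]|jL].
    by rewrite inE => /andP[].
  by exists j => //; rewrite inE; apply/andP.
rewrite orFb; case: imsetP => // -[l _ [E _]].
by rewrite E eqxx in neik.
Qed.

Lemma shuffle_signU1r k K L : k \notin L ->
  shuffle_sign C K (k |: L)%SET =
  (-1) ^+ #|[set i in K | (k < i)%N]%SET| * shuffle_sign C K L.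
Proof.
move=> kL; rewrite /shuffle_sign -exprD; congr (_ ^+ _).
have inj : injective (fun i : 'I_n => (i, k)) by move=> i j [].
rewrite -(card_imset _ inj) -cardsUI [X in (_ = #|pred_of_set X| + _)%N](_ : _ =
  [set p | [&& p.1 \in K, p.2 \in (k |: L)%SET & (p.2 < p.1)%N]]%SET).
  rewrite [X in (_ + #|pred_of_set X|)%N](_ : _ = finset.set0) ?cards0 ?addn0 //.
  apply/setP => -[i j]; rewrite !inE /=; apply/negbTE; apply/negP.
  case/andP => /imsetP[l _ [_ ->]]; by rewrite (negPf kL) andbF.
apply/setP => -[i j]; rewrite !inE /=.
have [->|nejk] := eqVneq j k.
  rewrite (negPf kL) /= andbF orbF; apply/imsetP/andP => [[l + [->]]|jK].
    by rewrite inE => /andP[].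
  by exists i => //; rewrite inE; apply/andP.
rewrite orFb; case: imsetP => // -[l _ [_ E]].
by rewrite E eqxx in nejk.
Qed.

Lemma card_split_at k K : k \notin K ->
  #|K| = (#|[set j in K | (j < k)%N]%SET| + #|[set j in K | (k < j)%N]%SET|)%N.
Proof.
move=> kK; rewrite -cardsUI [X in (_ + #|pred_of_set X|)%N](_ : _ = finset.set0).
  rewrite cards0 addn0; apply: eq_card => i; rewrite !inE -andb_orr -neq_ltn.
  by case: eqP => [/val_inj->|_]; rewrite ?andbT // (negPf kK).
apply/setP => i; rewrite !inE; apply/negbTE; apply/negP.
by case/andP=> /andP[_ ik] /andP[_]; rewrite ltnNge (ltnW ik).
Qed.

(** Moving k from the first to the second argument of shuffle_sign.  The sign
    (-1)^|K| counts the elements of K below k and those above k. *)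
Lemma shuffle_sign_move k K L : k \notin K -> k \notin L ->
  ins_sign C k (k |: L)%SET * shuffle_sign C K (k |: L)%SET =
  (-1) ^+ #|K| * (ins_sign C k (k |: K)%SET * shuffle_sign C (k |: K)%SET L).
Proof.
move=> kK kL; rewrite shuffle_signU1l // shuffle_signU1r // !ins_signU1 // ltnn.
rewrite !expr0 !mul1r (card_split_at kK) exprD /ins_sign.
have E (p q a s : C) : p * p = 1 -> a * (q * s) = p * q * (p * (a * s)).
  by move=> pp; transitivity (p * p * (a * (q * s))); [rewrite pp mul1r | ring].
by apply: E; rewrite -expr2 sqrr_sign.
Qed.

Lemma flat_star_wedge_delta k b :
  flat_star (wedge (delta_mx ord0 k) b) =
  iprod (delta_mx ord0 k) (flat_star (degscale (fun p => (-1) ^+ p) b)).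
Proof.
apply: extformP => K; rewrite flat_starE wedge_deltaE iprod_deltaE inE.
case: (boolP (k \in K)) => kK /=; first by rewrite mulr0.
rewrite flat_starE degscaleE.
have -> : (~: (k |: K) = ~: K :\ k)%SET.
  by apply/setP => i; rewrite !inE negb_or.
have kK' : k \notin (~: K :\ k)%SET by rewrite !inE eqxx.
have := shuffle_sign_move kK' kK; rewrite finset.setD1K ?inE // => E.
have sgn : (-1) ^+ #|(~: K :\ k)%SET| * (-1) ^+ #|(~: K :\ k)%SET| = 1 :> C.
  by rewrite -expr2 sqrr_sign.
by rewrite mulrA [ins_sign _ _ (k |: K)%SET * _]mulrA E; ring: sgn.
Qed.

Lemma flat_star_iprod_delta k b :
  flat_star (iprod (delta_mx ord0 k) b) =
  - wedge (delta_mx ord0 k) (flat_star (degscale (fun p => (-1) ^+ p) b)).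
Proof.
apply: extformP => K; rewrite extformNE flat_starE wedge_deltaE iprod_deltaE inE.
case: (boolP (k \in K)) => kK /=; last by rewrite mulr0 oppr0.
rewrite flat_starE degscaleE.
have -> : (~: (K :\ k) = k |: ~: K)%SET.
  by apply/setP => i; rewrite !inE negb_and negbK.
have kK1 : k \notin (~: K)%SET by rewrite inE negbK.
have kK2 : k \notin (K :\ k)%SET by rewrite !inE eqxx.
have := shuffle_sign_move kK1 kK2; rewrite finset.setD1K // => E.
have sgn2 : ins_sign C k K * ins_sign C k K = 1 by rewrite -[RHS](ins_signK k K) mulr1.
have {}E : shuffle_sign C (~: K)%SET K = ins_sign C k K *
    ((-1) ^+ #|(~: K)%SET| * (ins_sign C k (k |: ~: K)%SET *
      shuffle_sign C (k |: ~: K)%SET (K :\ k)%SET)).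
  by rewrite -E mulrA sgn2 mul1r.
have sgn3 : ins_sign C k (k |: ~: K)%SET * ins_sign C k (k |: ~: K)%SET = 1.
  by rewrite -[RHS](ins_signK k (k |: ~: K)%SET) mulr1.
by rewrite cardsU1 kK1 exprD expr1 E; ring: sgn3.
Qed.

Lemma flat_star_wedge v b :
  flat_star (wedge v b) =
  iprod v (flat_star (degscale (fun p => (-1) ^+ p) b)).
Proof.
rewrite wedge_sum iprod_sum linear_sum; apply: eq_bigr => k _.
by rewrite linearZ /= flat_star_wedge_delta.
Qed.

Lemma flat_star_iprod v b :
  flat_star (iprod v b) =
  - wedge v (flat_star (degscale (fun p => (-1) ^+ p) b)).
Proof.
rewrite wedge_sum iprod_sum linear_sum -sumrN; apply: eq_bigr => k _.
by rewrite linearZ /= flat_star_iprod_delta scalerN.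
Qed.

Lemma degscale_flat_star b :
  degscale (fun p => (-1) ^+ p) (flat_star b) =
  (-1) ^+ n *: flat_star (degscale (fun p => (-1) ^+ p) b).
Proof.
apply: extformP => K; rewrite extformZE degscaleE !flat_starE degscaleE.
have -> : (-1) ^+ n = (-1) ^+ #|K| * (-1) ^+ #|(~: K)%SET| :> C.
  by rewrite -exprD cardsC card_ord.
have sgn : (-1) ^+ #|(~: K)%SET| * (-1) ^+ #|(~: K)%SET| = 1 :> C.
  by rewrite -expr2 sqrr_sign.
by ring: sgn.
Qed.

(** Up to the factor det G, the star of the metric with inverse Gram matrix G
    squares to (-1)^(p (n - p)) = (-1)^((n + 1) p) on p-forms.  The left-hand
    side commutes with products by covectors up to the sign (-1)^(n + 1), so it
    is determined by its value at 1. *)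
Lemma flat_star_twice G b : G^T = G ->
  flat_star (form_map G (flat_star (form_map G b))) =
  row_wedge G [set: 'I_n]%SET [set: 'I_n]%SET *:
    degscale (fun p => (-1) ^+ (n.+1 * p)) b.
Proof.
move=> symG; elim/extform_ind: b => [|a b c Hb Hc|k b Hb].
- rewrite form_map_one flat_star_one row_wedge_top linearZ /= flat_star_top.
  by rewrite degscale_one muln0 expr0 scale1r.
- by rewrite !linearP /= Hb Hc.
rewrite form_map_wedge_delta flat_star_wedge.
have -> Y : form_map G (iprod (row k G) Y) = iprod (delta_mx ord0 k) (form_map G Y).
  by rewrite iprod_form_map symG rowE.
rewrite flat_star_iprod !degscale_form_map degscale_flat_star.
rewrite degscale_form_map degscale_comp.
have -> : degscale (fun p => (-1) ^+ p * (-1) ^+ p) b = b.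
  by apply: extformP => K; rewrite degscaleE -expr2 sqrr_sign mul1r.
rewrite !linearZ /= Hb degscale_wedge.
have -> : degscale ((fun p => (-1) ^+ (n.+1 * p)) \o succn) b =
  (-1) ^+ n.+1 *: degscale (fun p => (-1) ^+ (n.+1 * p)) b.
  by apply: extformP => K; rewrite extformZE !degscaleE /= mulnS exprD mulrA.
rewrite !linearZ /= !scalerA.
rewrite scalerN -scaleNr; congr (_ *: _).
by rewrite exprS mulN1r mulNr mulrC.
Qed.

End ExteriorAlgebra.

Section TopForm.
Local Open Scope ring_scope.
Variable C : comNzRingType.

(** Pullback along the inclusion of the coordinate hyperplane x_k = 0. *)
Definition form_pull n (k : 'I_n.+1) (b : extform C n.+1) : extform C n :=
  [ffun K : {set 'I_n} => b (lift k @: K)%SET].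

Lemma form_pull_wedge n (k : 'I_n.+1) (v : 'rV[C]_n.+1) b :
  form_pull k (wedge v b) = wedge (col' k v) (form_pull k b).
Proof.
apply: extformP => K; rewrite ffunE !wedgeE big_imset /=; last first.
  by move=> i j _ _; apply: lift_inj.
apply: eq_bigr => j jK; rewrite !mxE ffunE.
have -> : (lift k @: (K :\ j) = (lift k @: K) :\ lift k j)%SET.
  apply/setP => i; rewrite !inE; apply/imsetP/andP => [[l]|[ne /imsetP[l lK E]]].
    by rewrite !inE => /andP[ne lK] ->; rewrite (inj_eq lift_inj) ne imset_f.
  by exists l; rewrite // !inE lK andbT; apply: contra_neq ne => <-.
congr (_ * _ * _); rewrite /ins_sign; congr (_ ^+ _).
rewrite -(card_imset _ (@lift_inj _ k)); apply: eq_card => i.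
rewrite !inE; apply/andP/imsetP => [[/imsetP[l lK ->]]|[l + ->]].
  by rewrite /= ltnNge leq_bump2 -ltnNge => lj; exists l; rewrite ?inE ?lK.
by rewrite !inE => /andP[lK lj]; rewrite imset_f //= ltnNge leq_bump2 -ltnNge.
Qed.

(** The top minor is the determinant, by expansion along the first row. *)
Lemma row_wedge_det n (A : 'M[C]_n) :
  row_wedge A [set: 'I_n]%SET [set: 'I_n]%SET = \det A.
Proof.
elim: n A => [|n IHn] A.
  rewrite det_mx00 (_ : [set: 'I_0]%SET = finset.set0); last by apply/setP => -[].
  by rewrite row_wedge0 ffunE eqxx.
rewrite (expand_det_row _ ord0) {1}/row_wedge enum_setT -enumT enum_ordSl /= wedgeE.
apply: eq_big => [k|k _]; first by rewrite inE.
rewrite mxE /cofactor -IHn mulrCA mulrA; congr (_ * _ * _).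
  rewrite /ins_sign -[X in _ = (-1) ^+ X]add0n; congr (_ ^+ _).
  transitivity (\sum_(j < n.+1 | (j < k)%N) 1)%N.
    by rewrite sum1dep_card; apply: eq_card => j; rewrite !inE.
  by rewrite (big_ord_narrow (ltnW (ltn_ord k))) sum1_card card_ord.
have -> : ([set: 'I_n.+1] :\ k = lift k @: [set: 'I_n])%SET.
  apply/setP => i; rewrite !inE andbT; apply/idP/imsetP => [ik|[j _ ->]].
    by have /unlift_some[j Ej _] : k != i by [rewrite eq_sym]; exists j.
  by rewrite eq_sym neq_lift.
rewrite /row_wedge enum_setT -enumT; elim: (enum 'I_n) [set: 'I_n]%SET => [|j s IHs] L /=.
  by rewrite !ffunE imset_eq0.
have /(congr1 (fun b : extform C n => b L)) := form_pull_wedge k (row (lift ord0 j) A)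
  (foldr (fun i : 'I_n.+1 => [eta wedge (row i A)]) (form_one C n.+1) [seq lift ord0 i | i <- s]).
rewrite ffunE => ->.
have -> : col' k (row (lift ord0 j) A) = row j (row' ord0 (col' k A)).
  by apply/rowP => l; rewrite !mxE.
congr (wedge _ _ L); apply: extformP => M; rewrite ffunE; exact: IHs.
Qed.
End TopForm.

(** * The metric on forms and the symbol of the codifferential *)

Section MetricAlgebra.
Local Open Scope ring_scope.
Variables (R : realType) (n : nat).
Notation C := R[i].
Implicit Types (g G : 'M[R]_n) (a b : extform C n).

Lemma conj_real_complex (x : R) : Num.conj (real_complex R x) = real_complex R x.
Proof. by apply: conj_Creal; rewrite complex_real. Qed.

Lemma toC_mul m p q (A : 'M[R]_(m, p)) (B : 'M[R]_(p, q)) :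
  toC (A *m B) = toC A *m toC B.
Proof. exact: map_mxM. Qed.

Lemma toC_tr m p (A : 'M[R]_(m, p)) : toC A^T = (toC A)^T.
Proof. by rewrite /toC map_trmx. Qed.

Lemma toC1 m : toC (1%:M : 'M[R]_m) = 1%:M.
Proof. exact: map_mx1. Qed.

Lemma toC_row m p (A : 'M[R]_(m, p)) k : toC (row k A) = row k (toC A).
Proof. exact: map_row. Qed.

Lemma wedge_toC (v : 'rV[R]_n) (c : extform R n) :
  wedge (toC v) [ffun I => real_complex R (c I)] =
  [ffun I => real_complex R (wedge v c I)].
Proof.
apply: extformP => K; rewrite [RHS]ffunE !wedgeE rmorph_sum /=.
apply: eq_bigr => k _; rewrite !rmorphM /= mxE ffunE.
by rewrite /ins_sign rmorphXn /= rmorphN rmorph1.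
Qed.

Lemma row_wedge_toC (A : 'M[R]_n) I :
  row_wedge (toC A) I = [ffun J => real_complex R (row_wedge A I J)].
Proof.
rewrite /row_wedge; elim: (enum _) => [|i s IHs] /=.
  by apply: extformP => K; rewrite !ffunE; case: eqP; rewrite ?rmorph1 ?rmorph0.
by rewrite IHs -toC_row wedge_toC.
Qed.

(** Complex conjugation of the coefficients. *)
Definition form_conj a : extform C n := [ffun I => Num.conj (a I)].

Lemma form_conjE a I : form_conj a I = Num.conj (a I).
Proof. by rewrite ffunE. Qed.

Lemma form_conjK a : form_conj (form_conj a) = a.
Proof. by apply: extformP => I; rewrite !form_conjE conjCK. Qed.

Lemma form_conjP (z : C) a b :
  form_conj (z *: a + b) = Num.conj z *: form_conj a + form_conj b.
Proof.
apply: extformP => I.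
by rewrite !(form_conjE, extformDE, extformZE) rmorphD rmorphM.
Qed.

Lemma form_conj_wedge (v : 'rV[R]_n) a :
  form_conj (wedge (toC v) a) = wedge (toC v) (form_conj a).
Proof.
apply: extformP => K; rewrite form_conjE !wedgeE rmorph_sum /=.
apply: eq_bigr => k _; rewrite !rmorphM /= form_conjE mxE conj_real_complex.
by rewrite /ins_sign rmorphXn /= rmorphN rmorph1.
Qed.

Lemma form_conj_one : form_conj (form_one C n) = form_one C n.
Proof.
by apply: extformP => K; rewrite form_conjE !ffunE; case: eqP;
  rewrite ?rmorph1 ?rmorph0.
Qed.

Lemma toC_delta k : toC (delta_mx ord0 k : 'rV[R]_n) = delta_mx ord0 k.
Proof. exact: map_delta_mx. Qed.

Lemma form_conj_map (A : 'M[R]_n) a :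
  form_conj (form_map (toC A) a) = form_map (toC A) (form_conj a).
Proof.
elim/extform_ind: a => [|z a b Ha Hb|k a Ha].
- by rewrite !(form_map_one, form_conj_one).
- by rewrite linearP !form_conjP Ha Hb linearP.
by rewrite form_map_wedge_delta -toC_row -toC_delta !form_conj_wedge Ha
  !form_map_wedge -toC_mul -rowE.
Qed.

Lemma form_dot_conj a b :
  form_dot (form_conj a) (form_conj b) = Num.conj (form_dot a b).
Proof.
rewrite /form_dot rmorph_sum; apply: eq_bigr => I _.
by rewrite !form_conjE rmorphM.
Qed.

Lemma form_pairing_dot g a b :
  form_pairing g a b = form_dot a (form_map (toC (invmx g))^T b).
Proof.
rewrite -form_map_adj /form_pairing exchange_big; apply: eq_bigr => J _ /=.
rewrite /form_map extform_sumE mulr_suml; apply: eq_bigr => I _.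
by rewrite extformZE.
Qed.

Lemma toC_invmx_sym g : g^T = g -> (toC (invmx g))^T = toC (invmx g).
Proof. by move=> symg; rewrite -toC_tr trmx_inv symg. Qed.

Lemma form_herm_dot g a b : g^T = g ->
  form_herm g a b = form_dot (form_conj a) (form_map (toC (invmx g)) b).
Proof. by move=> symg; rewrite /form_herm form_pairing_dot toC_invmx_sym. Qed.

Lemma form_hermC g a b : g^T = g -> form_herm g b a = Num.conj (form_herm g a b).
Proof.
move=> symg; rewrite !form_herm_dot // -form_dot_conj form_conjK form_conj_map.
by rewrite [RHS]form_dotC form_map_adj toC_invmx_sym.
Qed.

Lemma form_hermDl g (z : C) a1 a2 b : g^T = g ->
  form_herm g (z *: a1 + a2) b = Num.conj z * form_herm g a1 b + form_herm g a2 b.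
Proof. by move=> symg; rewrite !form_herm_dot // form_conjP form_dotDl. Qed.

Lemma form_hermDr g (z : C) a b1 b2 : g^T = g ->
  form_herm g a (z *: b1 + b2) = z * form_herm g a b1 + form_herm g a b2.
Proof. by move=> symg; rewrite !form_herm_dot // linearP form_dotDr. Qed.

Lemma form_herm_wedge g (u : 'rV[R]_n) a b : g^T = g ->
  form_herm g (wedge (toC u) a) b =
  form_herm g a (iprod (toC (u *m invmx g)) b).
Proof.
move=> symg; rewrite !(form_herm_dot _ _ symg) form_conj_wedge form_dot_wedge.
by rewrite toC_mul iprod_form_map toC_invmx_sym.
Qed.

Lemma form_herm_iprod g (u : 'rV[R]_n) a b : g^T = g ->
  form_herm g (iprod (toC (u *m invmx g)) a) b =
  form_herm g a (wedge (toC u) b).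
Proof.
move=> symg; rewrite form_hermC // -form_herm_wedge // form_hermC //.
by rewrite conjCK.
Qed.

(** Antilinear functionals are represented by the metric.  Positivity is not
    needed, invertibility of the Gram matrix suffices. *)
Lemma form_herm_riesz g (phi : extform C n -> C) : g^T = g -> g \in unitmx ->
  (forall z a b, phi (z *: a + b) = Num.conj z * phi a + phi b) ->
  exists b, forall a, phi a = form_herm g a b.
Proof.
move=> symg ug phiP.
exists (form_map (toC g) [ffun I => phi (dform C I)]) => a.
rewrite form_herm_dot // form_map_comp -toC_mul mulmxV // toC1 form_map1.
have phi0 : phi 0 = 0.
  by have := phiP (-1) 0 0; rewrite scaleN1r addNr rmorphN rmorph1 mulN1r addNr.
rewrite {1}[a]extform_basis /form_dot.
elim/big_ind2: _ => // [x1 x2 y1 y2 <- <-|I _].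
  by rewrite -[x2]scale1r phiP rmorph1 mul1r scale1r.
by rewrite form_conjE ffunE -[_ *: _]addr0 phiP phi0 addr0.
Qed.

Lemma form_herm_inj g b1 b2 : g^T = g -> g \in unitmx ->
  (forall a, form_herm g a b1 = form_herm g a b2) -> b1 = b2.
Proof.
move=> symg ug eqb.
have E : form_map (toC (invmx g)) b1 = form_map (toC (invmx g)) b2.
  apply: extformP => I; rewrite -!form_dot_dform.
  have := eqb (form_conj (dform C I)).
  by rewrite !(form_herm_dot _ _ symg) form_conjK.
have := congr1 (form_map (toC g)) E.
by rewrite !form_map_comp -toC_mul mulVmx // toC1 !form_map1.
Qed.

Lemma hodgeE g b : g^T = g ->
  hodge g b = real_complex R (Num.sqrt (\det g)) *:
    flat_star (form_map (toC (invmx g)) b).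
Proof.
move=> symg; apply: extformP => K; rewrite extformZE flat_starE ffunE mulrA.
congr (_ * _); rewrite form_pairing_dot toC_invmx_sym // -form_dot_dform.
by congr form_dot; apply: extformP => I; rewrite !ffunE.
Qed.

(** The operation on the left is the symbol at u of d^* = a sign times star d star, with the sign
    (-1)^(n (p + 1) + 1) in degree p. *)
Lemma hodge_wedge_hodge g (u : 'rV[R]_n) b : g^T = g -> 0 < \det g ->
  hodge g (wedge (toC u)
    (hodge g (degscale (fun p => (-1) ^+ (n * (p + 1) + 1)) b))) =
  - iprod (toC (u *m invmx g)) b.
Proof.
move=> symg dg; rewrite !hodgeE // !linearZ /= scalerA -rmorphM /=.
rewrite -expr2 sqr_sqrtr ?ltW // form_map_wedge -toC_mul flat_star_wedge.
rewrite degscale_form_map degscale_flat_star degscale_form_map degscale_comp.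
rewrite !linearZ /= flat_star_twice ?toC_invmx_sym // row_wedge_det !linearZ /=.
rewrite !scalerA degscale_comp.
have -> : \det (toC (invmx g)) = real_complex R (\det g)^-1.
  by rewrite det_map_mx det_inv.
(* the sign of the codifferential, that of the square of the star and the one
   produced by exchanging the star and the wedge product combine to a sign
   independent of the degree *)
have -> : (fun p => (-1) ^+ (n.+1 * p) * ((-1) ^+ p * (-1) ^+ (n * (p + 1) + 1))) =
    (fun=> (-1) ^+ n.+1) :> (nat -> C).
  apply/funext => p; rewrite -!exprD -signr_odd -[RHS]signr_odd; congr (_ ^+ nat_of_bool _).
  rewrite !(oddD, oddM, oddS) /=.
  by case: (odd n); case: (odd p).
have -> : degscale (fun=> (-1) ^+ n.+1) b = (-1) ^+ n.+1 *: b.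
  by apply: extformP => K; rewrite degscaleE.
rewrite linearZ /= scalerA -[RHS]scaleN1r; congr (_ *: _).
rewrite -rmorphM /= (divff (lt0r_neq0 dg)) rmorph1 mul1r -exprD addnS addnn -mul2n.
by rewrite exprS exprM sqrrN !expr1n mulr1.
Qed.

End MetricAlgebra.

(** * Clifford multiplication by forms *)

Section CliffordMonomials.
Local Open Scope ring_scope.
Variables (C : comNzRingType) (n N : nat) (c : 'I_n -> 'M[C]_N).
Hypothesis c_anti : forall i j, i != j -> c i *m c j = - (c j *m c i).
Hypothesis c_sqr : forall i, c i *m c i = - 1%:M.

(** c(e^{i_1}) ... c(e^{i_p}) for I = {i_1 < ... < i_p}. *)
Definition cliff_mono (I : {set 'I_n}) : 'M[C]_N :=
  foldr (fun i M => c i *m M) 1%:M (enum I).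

(** Extension of c to forms, the dx^i being orthonormal. *)
Definition cliff_sum (b : extform C n) : 'M[C]_N := \sum_I b I *: cliff_mono I.

Lemma cliff_sum_linear : linear cliff_sum.
Proof.
move=> a b d; rewrite /cliff_sum scaler_sumr -big_split /=.
by apply: eq_bigr => I _; rewrite extformDE extformZE scalerDl scalerA.
Qed.
HB.instance Definition _ :=
  GRing.isLinear.Build C (extform C n) 'M[C]_N _ cliff_sum cliff_sum_linear.

Lemma cliff_sum_dform I : cliff_sum (dform C I) = cliff_mono I.
Proof.
rewrite /cliff_sum (bigD1 I) //= dformE eqxx scale1r big1 ?addr0 // => J neJI.
by rewrite dformE (negPf neJI) scale0r.
Qed.

Lemma cliff_monoD1 k (K : {set 'I_n}) : k \in K ->
  cliff_mono K = ins_sign C k K *: (c k *m cliff_mono (K :\ k)%SET).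
Proof.
move=> kK; apply: (foldr_enum_anticomm (f := fun i M => c i *m M)) kK.
  by move=> i a M; rewrite scalemxAr.
by move=> i j M neij; rewrite !mulmxA c_anti // mulNmx.
Qed.

(** On dx^I only one of the two terms is nonzero: the wedge product if k is not
    in I, the interior product if it is. *)
Lemma cliff_sum_wedge_delta k b :
  cliff_sum (wedge (delta_mx ord0 k) b - iprod (delta_mx ord0 k) b) =
  c k *m cliff_sum b.
Proof.
pose f := cliff_sum \o (wedge (delta_mx ord0 k) \- iprod (delta_mx ord0 k)).
rewrite -[LHS]/(f b) -[RHS]/((mulmx (c k) \o cliff_sum) b).
apply: dform_ext => I; rewrite /f /= linearB /= cliff_sum_dform.
have sgnK (J : {set 'I_n}) (M : 'M[C]_N) :
    ins_sign C k J *: (ins_sign C k J *: M) = M.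
  by rewrite scalerA /ins_sign -expr2 sqrr_sign scale1r.
have [kI|kI] := boolP (k \in I).
  rewrite wedge_delta_dform0 // linear0 sub0r.
  rewrite (cliff_monoD1 kI) -scalemxAr mulmxA c_sqr mulNmx mul1mx scalerN.
  by rewrite iprod_delta_dform // linearZ /= cliff_sum_dform.
rewrite iprod_delta_dform0 //.
rewrite linear0 subr0 -[RHS](sgnK (k |: I)%SET).
have := cliff_monoD1 (setU11 k I); rewrite setU1K // => <-.
by rewrite -cliff_sum_dform wedge_delta_dform // linearZ /= sgnK.
Qed.

Lemma cliff_sum_wedge (v : 'rV[C]_n) b :
  cliff_sum (wedge v b - iprod v b) =
  (\sum_k v ord0 k *: c k) *m cliff_sum b.
Proof.
rewrite wedge_sum iprod_sum -sumrB linear_sum mulmx_suml; apply: eq_bigr => k _.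
by rewrite -scalerBr linearZ /= cliff_sum_wedge_delta scalemxAl.
Qed.

End CliffordMonomials.

Section CliffordForms.
Local Open Scope ring_scope.
Variables (R : realType) (n : nat) (X : oriented_riemannian R n).
Variable W : spinc_bundle X.
Notation C := R[i].
Variables (x : X) (e : 'M[R]_n).
Hypothesis he : orthonormal_coframe x e.
Local Notation G := (invmx (metric x)).

Lemma coframe_mx : e *m G *m e^T = 1%:M.
Proof.
apply/matrixP => i j; have := he i j; rewrite /covector_dot => E.
rewrite mxE -[RHS]/(1%:M i j) !mxE -E mxE; apply: eq_bigr => k _.
by rewrite !mxE; congr (_ * _); apply: eq_bigr => l _; rewrite !mxE.
Qed.

Lemma coframe_mxV : G *m e^T *m e = 1%:M.
Proof. by apply: mulmx1C; rewrite mulmxA coframe_mx. Qed.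

Lemma metric_unit : metric x \in unitmx.
Proof.
rewrite -unitmx_inv; have [] // := mulmx1_unit (_ : G *m (e^T *m e) = 1%:M).
by rewrite mulmxA coframe_mxV.
Qed.

(** Read off from the coframe: det g is the square of det e. *)
Lemma metric_det_gt0 : 0 < \det (metric x).
Proof.
have E : \det e ^+ 2 / \det (metric x) = 1.
  have := congr1 determinant coframe_mx.
  by rewrite !det_mulmx det_tr det1 det_inv mulrAC -expr2.
rewrite -[\det (metric x)]invrK invr_gt0.
have [d0|d0] := eqVneq (\det e) 0.
  by move/eqP: E; rewrite d0 expr0n mul0r eq_sym oner_eq0.
by rewrite -(pmulr_rgt0 _ (_ : 0 < \det e ^+ 2)) ?E ?ltr01 // exprn_even_gt0.
Qed.

Lemma clif_sum (v : 'rV[R]_n) :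
  clif W x (v *m e) = \sum_k (toC v) ord0 k *: clif W x (row k e).
Proof.
have lin0 : clif W x 0 = 0.
  by have := clif_linear W x 1 0 0; rewrite !scale1r addr0 => /esym/eqP;
    rewrite -subr_eq0 addrK => /eqP.
have -> : v *m e = \sum_k v ord0 k *: row k e.
  rewrite {1}(row_sum_delta v) mulmx_suml; apply: eq_bigr => k _.
  by rewrite -scalemxAl -rowE.
elim/big_ind2: _ => // [x1 x2 y1 y2 <- <-|k _].
  by rewrite -[x2]scale1r clif_linear !scale1r.
by rewrite -[_ *: _]addr0 clif_linear lin0 addr0 mxE.
Qed.

(** The coefficients of b in the coframe e are those of the image of b under
    the inverse of e. *)
Lemma clif_formE b : clif_form W x e b =
  cliff_sum (fun k => clif W x (row k e)) (form_map (toC (G *m e^T)) b).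
Proof.
apply: eq_bigr => I _; congr (_ *: _).
rewrite (form_herm_dot _ _ (Defs.metric_sym x)) -form_map_dform form_conj_map.
rewrite form_map_adj -toC_tr form_map_comp -toC_mul.
rewrite -[RHS]form_dot_dform; congr form_dot.
by apply: extformP => J; rewrite form_conjE !dformE; case: (_ == _); rewrite ?rmorph1 ?rmorph0.
Qed.

(** c(u) c(b) = c(u /\ b - iota_u b). *)
Lemma clif_form_wedge (u : 'rV[R]_n) b :
  clif_form W x e (wedge (toC u) b - iprod (toC (u *m G)) b) =
  clif W x u *m clif_form W x e b.
Proof.
rewrite !clif_formE linearB /= form_map_wedge -toC_mul.
have -> : form_map (toC (G *m e^T)) (iprod (toC (u *m G)) b) =
    iprod (toC (u *m (G *m e^T))) (form_map (toC (G *m e^T)) b).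
  rewrite iprod_form_map -toC_tr -toC_mul; congr (form_map _ (iprod (toC _) b)).
  rewrite trmx_mul trmxK trmx_inv Defs.metric_sym -!mulmxA; congr (u *m _).
  by rewrite !mulmxA coframe_mxV mul1mx.
rewrite cliff_sum_wedge -?clif_sum.
- by rewrite -mulmxA coframe_mxV mulmx1.
- move=> i j ij; apply/eqP; rewrite -addr_eq0 clif_relation (he i j) (negPf ij).
  by rewrite mulr0 ?rmorph0 ?raddf0.
- move=> i; have := clif_relation W x (row i e) (row i e).
  rewrite (he i i) eqxx mulr1 => E.
  apply: (@scalerI _ _ 2%:R); first by rewrite pnatr_eq0.
  by rewrite scaler_nat mulr2n E rmorphN rmorph_nat scalerN scalemx1 raddfN.
Qed.

End CliffordForms.

(** * Smooth functions and directional derivatives *)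

Section Calculus.
Local Open Scope ring_scope.
Local Open Scope classical_set_scope.
Variables (R : realType) (n : nat).
Notation C := R[i].
Implicit Types (f h : 'rV[R]_n -> R) (p v : 'rV[R]_n).

Lemma near_eq_partial f h p j :
  (\forall q \near p, f q = h q) -> partial j f p = partial j h p.
Proof. by move=> fh; rewrite /partial (near_eq_derive _ fh). Qed.

Lemma near_eq_continuous f h p : (\forall q \near p, f q = h q) ->
  {for p, continuous f} -> {for p, continuous h}.
Proof.
move=> fh fc; have E := nbhs_singleton fh.
suff : h @ p --> f p by rewrite E.
apply: cvg_trans fc; exact: (@near_eq_cvg _ _ (nbhs p) (nbhs_filter p) f h fh).
Qed.

Lemma near_eq_Ck k f h p : (\forall q \near p, f q = h q) -> Ck k f p -> Ck k h p.
Proof.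
elim: k f h p => [|k IHk] f h p fh [fc].
  move=> _; split=> //; apply: filterS2 fc (near_join fh) => q fc fhq.
  exact: near_eq_continuous fc.
move=> [df kf]; split; last split.
- apply: filterS2 fc (near_join fh) => q fc fhq.
  exact: near_eq_continuous fc.
- apply: filterS2 df (near_join fh) => q df fhq j.
  exact: near_eq_derivable fhq (df j).
- move=> j; apply: IHk (kf j); apply: filterS (near_join fh) => q fhq.
  exact: near_eq_partial.
Qed.

Lemma near_eq_smooth_at f h p :
  (\forall q \near p, f q = h q) -> smooth_at f p -> smooth_at h p.
Proof.
move=> fh sf; apply: filterS2 (near_join fh) sf => q fhq fk k.
exact: near_eq_Ck (fk k).
Qed.

Lemma near_eq_smoothC_at (f h : 'rV[R]_n -> C) p :
  (\forall q \near p, f q = h q) -> smoothC_at f p -> smoothC_at h p.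
Proof.
move=> fh [f1 f2]; split; [move: f1|move: f2]; apply: near_eq_smooth_at;
  by apply: filterS fh => q ->.
Qed.

Lemma partial_cst (c : R) p j : partial j (fun=> c) p = 0.
Proof. exact: derive_cst. Qed.

Lemma Ck_cst k (c : R) p : Ck k (fun=> c) p.
Proof.
have cont : \forall q \near p, {for q, continuous (fun=> c : R)}.
  by apply: (@nearW _ (nbhs p)) => q; exact: cst_continuous.
elim: k c p cont => [|k IHk] c p cont; first by split.
split => //; split; first by apply: (@nearW _ (nbhs p)) => q j; exact: derivable_cst.
move=> j; have -> : partial j (fun=> c) = (fun=> 0).
  by apply/funext => q; exact: partial_cst.
by apply: IHk; apply: (@nearW _ (nbhs p)) => q; exact: cst_continuous.
Qed.

Lemma smooth_at_cst (c : R) p : smooth_at (fun=> c) p.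
Proof. by apply: (@nearW _ (nbhs p)) => q k; exact: Ck_cst. Qed.

Lemma smoothC_at_cst (c : C) p : smoothC_at (fun=> c) p.
Proof. by split; apply: smooth_at_cst. Qed.

Lemma is_derive_coord (i : 'I_n) p v :
  is_derive p v (fun q : 'rV[R]_n => q ord0 i) (v ord0 i).
Proof.
have did : derivable (@id 'rV[R]_n) p v by exact: derivable_id.
apply: DeriveDef; first exact: (derivable_mxP _ _ _).1 did ord0 i.
by have := derive_mx did; rewrite derive_id => /rowP/(_ i); rewrite mxE.
Qed.

Lemma partial_coord (i j : 'I_n) p :
  partial j (fun q : 'rV[R]_n => q ord0 i) p = (i == j)%:R.
Proof.
by rewrite /partial (@derive_val _ _ _ _ _ _ _ (is_derive_coord i p _)) mxE eqxx.
Qed.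

Lemma is_derive_linear (u : 'rV[R]_n) p v :
  is_derive p v (fun q : 'rV[R]_n => \sum_i u ord0 i * q ord0 i)
    (\sum_i u ord0 i * v ord0 i).
Proof.
have -> : (fun q : 'rV[R]_n => \sum_i u ord0 i * q ord0 i) =
    \sum_i (fun q : 'rV[R]_n => u ord0 i *: q ord0 i).
  by apply/funext => q; rewrite fct_sumE.
apply: is_derive_sum => i; apply: is_deriveZ; exact: is_derive_coord.
Qed.

Lemma partial_linear (u : 'rV[R]_n) p j :
  partial j (fun q : 'rV[R]_n => \sum_i u ord0 i * q ord0 i) p = u ord0 j.
Proof.
rewrite /partial (@derive_val _ _ _ _ _ _ _ (is_derive_linear u p _)).
rewrite (bigD1 j) //= mxE !eqxx mulr1 big1 ?addr0 // => i ij.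
by rewrite mxE (negPf ij) andbF mulr0.
Qed.

Lemma smooth_at_linear (u : 'rV[R]_n) p :
  smooth_at (fun q : 'rV[R]_n => \sum_i u ord0 i * q ord0 i) p.
Proof.
have cont q : {for q, continuous (fun q : 'rV[R]_n => \sum_i u ord0 i * q ord0 i)}.
  rewrite (_ : (fun _ => _) = \sum_i (fun q : 'rV[R]_n => u ord0 i * q ord0 i)).
    apply/differentiable_continuous/differentiable_sum => i.
    exact/differentiableZ/differentiable_coord.
  by apply/funext => r; rewrite fct_sumE.
apply: (@nearW _ (nbhs p)) => q [|k]; split => //.
- by apply: (@nearW _ (nbhs q)) => r; exact: cont.
- by apply: (@nearW _ (nbhs q)) => r; exact: cont.
split.
  by apply: (@nearW _ (nbhs q)) => r j; exact: (@ex_derive _ _ _ _ _ _ _ (is_derive_linear u r _)).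
move=> j; rewrite (_ : partial j _ = (fun=> u ord0 j)); first exact: Ck_cst.
by apply/funext => r; exact: partial_linear.
Qed.

Lemma smooth_at_derivable f p j :
  smooth_at f p -> derivable f p (delta_mx ord0 j).
Proof. by move=> /nbhs_singleton/(_ 1%N)[_ [/nbhs_singleton]]. Qed.

Lemma derivable_sum_fun (I : Type) (s : seq I) (P : pred I)
    (F : I -> 'rV[R]_n -> R) p v :
  (forall i, derivable (F i) p v) ->
  derivable (fun q => \sum_(i <- s | P i) F i q) p v.
Proof.
move=> dF; elim: s => [|i s IHs].
  rewrite (_ : (fun _ => _) = fun=> 0); first exact: derivable_cst.
  by apply/funext => q; rewrite big_nil.
have [Pi|/negbTE Pi] := boolP (P i).
  rewrite (_ : (fun _ => _) = F i + (fun q => \sum_(i <- s | P i) F i q)).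
    exact: derivableD (dF i) IHs.
  by apply/funext => q; rewrite big_cons Pi.
rewrite (_ : (fun _ => _) = fun q => \sum_(i <- s | P i) F i q) //.
by apply/funext => q; rewrite big_cons Pi.
Qed.

Lemma derivable_prod_fun (I : Type) (s : seq I) (F : I -> 'rV[R]_n -> R) p v :
  (forall i, derivable (F i) p v) ->
  derivable (fun q => \prod_(i <- s) F i q) p v.
Proof.
move=> dF; elim: s => [|i s IHs].
  rewrite (_ : (fun _ => _) = fun=> 1); first exact: derivable_cst.
  by apply/funext => q; rewrite big_nil.
rewrite (_ : (fun _ => _) = F i * (fun q => \prod_(i <- s) F i q)).
  exact: derivableM (dF i) IHs.
by apply/funext => q; rewrite big_cons.
Qed.

Lemma derivable_mul_fun f h p v : derivable f p v -> derivable h p v ->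
  derivable (fun q => f q * h q) p v.
Proof. exact: derivableM. Qed.

Lemma derivable_cstM (c : R) f p v :
  derivable f p v -> derivable (fun q => c * f q) p v.
Proof. exact: derivableZ. Qed.

Lemma derivable_det m (M : 'rV[R]_n -> 'M[R]_m) p v :
  (forall i j, derivable (fun q => M q i j) p v) ->
  derivable (fun q => \det (M q)) p v.
Proof.
move=> dM; apply: derivable_sum_fun => s; apply: derivable_cstM.
exact: derivable_prod_fun.
Qed.

Lemma derivable_invmx m (M : 'rV[R]_n -> 'M[R]_m) p v :
  (forall i j, derivable (fun q => M q i j) p v) ->
  (\forall q \near p, M q \in unitmx) ->
  forall i j, derivable (fun q => invmx (M q) i j) p v.
Proof.
move=> dM uM i j.
apply: (@near_eq_derivable _ _ _
  (fun q => (\det (M q))^-1 * cofactor (M q) j i)).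
  by apply: filterS uM => q uq; rewrite /invmx uq !mxE.
apply: derivable_mul_fun.
  apply: derivableV; last exact: derivable_det.
  by rewrite -unitfE; exact: nbhs_singleton uM.
apply: derivable_cstM; apply: derivable_det => k l.
by under eq_fun do rewrite !mxE; exact: dM.
Qed.

Lemma derivable_sqrt f p v : 0 < f p -> derivable f p v ->
  derivable (fun q => Num.sqrt (f q)) p v.
Proof.
move=> fp /derivable1P/derivable1_diffP df; apply/derivable1P/derivable1_diffP.
apply: (differentiable_comp df); apply/derivable1_diffP.
by apply: ex_derive; apply: is_derive1_sqrt; rewrite scale0r add0r.
Qed.

Lemma derivable_wedge (w : 'rV[R]_n -> 'rV[R]_n) (b : 'rV[R]_n -> extform R n) p v K :
  (forall i, derivable (fun q => w q ord0 i) p v) ->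
  (forall I, derivable (fun q => b q I) p v) ->
  derivable (fun q => wedge (w q) (b q) K) p v.
Proof.
move=> dw db; under eq_fun do rewrite wedgeE.
apply: derivable_sum_fun => k; apply: derivable_mul_fun => //.
exact: derivable_cstM.
Qed.

Lemma derivable_row_wedge (M : 'rV[R]_n -> 'M[R]_n) p v I J :
  (forall i j, derivable (fun q => M q i j) p v) ->
  derivable (fun q => row_wedge (M q) I J) p v.
Proof.
move=> dM; rewrite /row_wedge; elim: (enum I) J => [|i s IHs] J /=.
  exact: derivable_cst.
apply: derivable_wedge => // k.
by under eq_fun do rewrite mxE; exact: dM.
Qed.

(** Directional differentiability of the real and imaginary parts. *)
Definition derivableC (f : 'rV[R]_n -> C) p v : Prop :=
  derivable (fun q => complex.Re (f q)) p v /\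
  derivable (fun q => complex.Im (f q)) p v.

Lemma smoothC_at_derivable (f : 'rV[R]_n -> C) p j :
  smoothC_at f p -> derivableC f p (delta_mx ord0 j).
Proof. by move=> [f1 f2]; split; apply: smooth_at_derivable. Qed.

Lemma Re_realM (a : R) (z : C) : complex.Re (real_complex R a * z) = a * complex.Re z.
Proof. by case: z => x y /=; rewrite mul0r subr0. Qed.

Lemma Im_realM (a : R) (z : C) : complex.Im (real_complex R a * z) = a * complex.Im z.
Proof. by case: z => x y /=; rewrite mul0r addr0. Qed.

Lemma ReD (z w : C) : complex.Re (z + w) = complex.Re z + complex.Re w.
Proof. by case: z; case: w. Qed.

Lemma ImD (z w : C) : complex.Im (z + w) = complex.Im z + complex.Im w.
Proof. by case: z; case: w. Qed.

Lemma derivableC_realM f (b : 'rV[R]_n -> C) p v :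
  derivable f p v -> derivableC b p v ->
  derivableC (fun q => real_complex R (f q) * b q) p v.
Proof.
move=> df [b1 b2]; split.
  by under eq_fun do rewrite Re_realM; exact: derivable_mul_fun.
by under eq_fun do rewrite Im_realM; exact: derivable_mul_fun.
Qed.

Lemma derivableC_sum (I : Type) (s : seq I) (P : pred I)
    (F : I -> 'rV[R]_n -> C) p v :
  (forall i, derivableC (F i) p v) ->
  derivableC (fun q => \sum_(i <- s | P i) F i q) p v.
Proof.
move=> dF; split.
  under eq_fun do rewrite (big_morph _ ReD (erefl _)).
  by apply: derivable_sum_fun => i; exact: (dF i).1.
under eq_fun do rewrite (big_morph _ ImD (erefl _)).
by apply: derivable_sum_fun => i; exact: (dF i).2.
Qed.

Lemma partialC_realM f (b : 'rV[R]_n -> C) p j :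
  derivable f p (delta_mx ord0 j) -> derivableC b p (delta_mx ord0 j) ->
  partialC j (fun q => real_complex R (f q) * b q) p =
  real_complex R (partial j f p) * b p + real_complex R (f p) * partialC j b p.
Proof.
move=> df [b1 b2]; rewrite /partialC.
under eq_fun do rewrite Re_realM.
under [X in Complex _ (partial j X p)]eq_fun do rewrite Im_realM.
have PM h : derivable h p (delta_mx ord0 j) ->
    partial j (fun q => f q * h q) p = f p * partial j h p + h p * partial j f p.
  by move=> dh; rewrite /partial; exact: (deriveM df dh).
rewrite (PM _ b1) (PM _ b2).
apply/eqP; rewrite eq_complex; apply/andP; split; apply/eqP.
  by rewrite ReD !Re_realM /= addrC [in RHS]mulrC.
by rewrite ImD !Im_realM /= addrC [in RHS]mulrC.
Qed.

Lemma ext_d_leibniz f (b : 'rV[R]_n -> extform C n) p :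
  (forall j, derivable f p (delta_mx ord0 j)) ->
  (forall I j, derivableC (fun q => b q I) p (delta_mx ord0 j)) ->
  ext_d (fun q => real_complex R (f q) *: b q) p =
  wedge (toC (\row_j partial j f p)) (b p) + real_complex R (f p) *: ext_d b p.
Proof.
move=> df db; rewrite wedge_sum scaler_sumr -big_split /=; apply: eq_bigr => j _.
rewrite !mxE -!linearZ -linearD /=; congr wedge; apply: extformP => I.
rewrite extformDE !extformZE [LHS]ffunE [X in _ * X + _]/= [X in _ + _ * X]ffunE.
under eq_fun do rewrite extformZE.
exact: partialC_realM.
Qed.

End Calculus.

(** * Leibniz rules and symbols *)

Section Codifferential.
Local Open Scope ring_scope.
Local Open Scope classical_set_scope.
Variables (R : realType) (n : nat).
Notation C := R[i].
Variables (g : 'rV[R]_n -> 'M[R]_n) (p : 'rV[R]_n).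
Hypothesis g_sym : (g p)^T = g p.
Hypothesis g_det : 0 < \det (g p).
Hypothesis g_unit : \forall q \near p, g q \in unitmx.
Hypothesis g_deriv : forall i j k, derivable (fun q => g q i j) p (delta_mx ord0 k).

(** The coefficients of the Hodge star are real; this is the form in which they
    are differentiated. *)
Lemma hodge_sum (M : 'M[R]_n) (b : extform C n) K : hodge M b K =
  \sum_J real_complex R (Num.sqrt (\det M) *
    (shuffle_sign R (~: K)%SET K * row_wedge (invmx M) (~: K)%SET J)) * b J.
Proof.
rewrite ffunE /form_pairing (bigD1 (~: K)%SET) //= [X in _ * (_ + X)]big1.
  rewrite addr0 mulr_sumr; apply: eq_bigr => J _.
  rewrite ffunE eqxx mul1r row_wedge_toC ffunE !rmorphM /= !mulrA.
  by rewrite /shuffle_sign rmorphXn /= rmorphN rmorph1.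
by move=> I /negPf neI; rewrite big1 // => J _; rewrite ffunE neI !mul0r.
Qed.

Lemma derivableC_hodge (b : 'rV[R]_n -> extform C n) K k :
  (forall I, derivableC (fun q => b q I) p (delta_mx ord0 k)) ->
  derivableC (fun q => hodge (g q) (b q) K) p (delta_mx ord0 k).
Proof.
move=> db.
rewrite (_ : (fun _ => _) = fun q => \sum_J real_complex R (Num.sqrt (\det (g q)) *
    (shuffle_sign R (~: K)%SET K * row_wedge (invmx (g q)) (~: K)%SET J)) * b q J).
  apply: derivableC_sum => J; apply: derivableC_realM (db J).
  apply: derivable_mul_fun; first by apply: derivable_sqrt => //; exact: derivable_det.
  apply: derivable_cstM; apply: derivable_row_wedge => i j.
  exact: derivable_invmx.
by apply/funext => q; exact: hodge_sum.
Qed.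

Lemma codiffE (b : 'rV[R]_n -> extform C n) : codiff g b p =
  hodge (g p) (ext_d (fun q =>
    hodge (g q) (degscale (fun m => (-1) ^+ (n * (m + 1) + 1)) (b q))) p).
Proof. by []. Qed.

Lemma hodge_linear (M : 'M[R]_n) : linear (@hodge R n M).
Proof.
move=> a b c; apply: extformP => K; rewrite extformDE extformZE !hodge_sum.
rewrite mulr_sumr -big_split /=; apply: eq_bigr => J _.
by rewrite extformDE extformZE mulrDr mulrCA.
Qed.

Lemma codiff_leibniz (f : 'rV[R]_n -> R) (b : 'rV[R]_n -> extform C n) :
  (forall j, derivable f p (delta_mx ord0 j)) ->
  (forall I j, derivableC (fun q => b q I) p (delta_mx ord0 j)) ->
  codiff g (fun q => real_complex R (f q) *: b q) p =
  - iprod (toC ((\row_j partial j f p) *m invmx (g p))) (b p) +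
    real_complex R (f p) *: codiff g b p.
Proof.
move=> df db; rewrite !codiffE -hodge_wedge_hodge //.
pose h m : C := (-1) ^+ (n * (m + 1) + 1); pose b' q := hodge (g q) (degscale h (b q)).
have hZ (M : 'M[R]_n) (a : C) (c : extform C n) : hodge M (a *: c) = a *: hodge M c.
  have h0 : hodge M 0 = 0.
    by have := hodge_linear M (-1) 0 0; rewrite scaleN1r addNr scaleN1r addNr.
  by rewrite -[a *: c]addr0 hodge_linear h0 addr0.
rewrite (_ : (fun q => _) = fun q => real_complex R (f q) *: b' q); last first.
  by apply/funext => q; rewrite linearZ hZ.
rewrite (ext_d_leibniz df); last first.
  move=> I j; apply: derivableC_hodge => J; have [b1 b2] := db J j.
  rewrite (_ : (fun q => _) = fun q => real_complex R ((-1) ^+ (n * (#|J| + 1) + 1)) * b q J).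
    by apply: derivableC_realM (db J j); exact: derivable_cst.
  by apply/funext => q; rewrite degscaleE /h rmorphXn /= rmorphN rmorph1.
by rewrite addrC hodge_linear addrC.
Qed.

End Codifferential.

Section Manifold.
Local Open Scope ring_scope.
Local Open Scope classical_set_scope.
Variables (R : realType) (n : nat) (X : oriented_manifold R n).
Notation C := R[i].

Lemma cinv_coord (x : X) : cinv (chart_at x) (Defs.coord x) = x.
Proof. by apply: cmapK; exact: chart_at_dom. Qed.

Lemma in_chart_coord (T : Type) (x : X) (f : X -> T) : in_chart x f (Defs.coord x) = f x.
Proof. by rewrite /in_chart cinv_coord. Qed.

Lemma near_coord_image (x : X) :
  \forall q \near Defs.coord x, (cmap (chart_at x) @` cdom (chart_at x)) q.
Proof.
apply: open_nbhs_nbhs; split; first exact: cimg_open.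
by exists x => //; exact: chart_at_dom.
Qed.

Lemma near_coord (x : X) (P : X -> Prop) : (\forall y \near x, P y) ->
  \forall q \near Defs.coord x, P (cinv (chart_at x) q).
Proof.
move=> nP; have := @cinv_cont _ _ _ (chart_at x) _ (nbhs_singleton (near_coord_image x)).
by move/(_ P); rewrite cinv_coord; apply.
Qed.

Lemma near_coord_dom (x : X) :
  \forall q \near Defs.coord x, cdom (chart_at x) (cinv (chart_at x) q).
Proof.
apply: filterS (near_coord_image x) => q [z zx <-].
by rewrite cmapK.
Qed.

Lemma cochange1 (x : X) : cochange x x = 1%:M.
Proof.
apply/matrixP => i j; rewrite !mxE -(partial_coord i j (Defs.coord x)).
apply: near_eq_partial; apply: filterS (near_coord_image x) => q [z zx <-].
by rewrite /transition cmapK.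
Qed.

Lemma cochange_unit (x y : X) : cdom (chart_at x) y -> cochange x y \in unitmx.
Proof.
move=> xy; rewrite unitmxE unitfE gt_eqF //; apply: chart_at_oriented => //.
exact: chart_at_dom.
Qed.

Lemma dfunC_real (f : X -> R) (x : X) :
  dfunC (fun y => real_complex R (f y)) x = toC (dfun f x).
Proof.
by apply/rowP => j; rewrite !mxE; congr Complex; exact: partial_cst.
Qed.

Lemma smooth_funC_real (f : X -> R) (x : X) :
  smooth_fun f x -> smooth_funC (fun y => real_complex R (f y)) x.
Proof. by move=> sf; split => //; exact: smooth_at_cst. Qed.

(** Linear functions of the coordinates at x are smooth near x, so that every
    covector is the differential of a smooth function. *)
Lemma exists_dfun (x : X) (u : 'rV[R]_n) :
  exists2 f : X -> R, smooth_fun f x & dfun f x = u.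
Proof.
pose f (y : X) := \sum_i u ord0 i * cmap (chart_at x) y ord0 i.
have E : \forall q \near Defs.coord x,
    \sum_i u ord0 i * (q : 'rV[R]_n) ord0 i = in_chart x f q.
  apply: filterS (near_coord_image x) => q [z zx <-].
  by rewrite /in_chart /f cmapK.
exists f; first exact: near_eq_smooth_at E (smooth_at_linear u _).
apply/rowP => j; rewrite mxE -[RHS](partial_linear u (Defs.coord x)).
by apply: near_eq_partial; apply: filterS E => q ->.
Qed.

Lemma near_eq_smooth_funC (f h : X -> C) x :
  (\forall y \near x, f y = h y) -> smooth_funC f x -> smooth_funC h x.
Proof. by move=> fh; apply: near_eq_smoothC_at; exact: (@near_coord x (fun y => f y = h y)). Qed.

(** The section has constant components in the local frame at x. *)
Lemma exists_section r (F : local_frames X r) (x : X) (s0 : 'cV[C]_r) :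
  is_vector_bundle F -> exists2 s, smooth_section F s x & s x = s0.
Proof.
move=> [Fopen Funit _]; have [Fo Fx] := Fopen x.
exists (fun y => fmat F x y *m (invmx (fmat F x x) *m s0)); last first.
  by rewrite mulmxA mulmxV ?mul1mx //; exact: Funit.
move=> i; apply: (@near_eq_smooth_funC (fun=> (invmx (fmat F x x) *m s0) i ord0)).
  have : nbhs x (fdom F x) by apply: open_nbhs_nbhs.
  apply: filterS => y Fy.
  by rewrite [in RHS]mulmxA mulVmx ?mul1mx //; exact: Funit.
exact: smoothC_at_cst.
Qed.

End Manifold.

Section RiemannianSymbols.
Local Open Scope ring_scope.
Local Open Scope classical_set_scope.
Variables (R : realType) (n : nat) (X : oriented_riemannian R n).
Notation C := R[i].

(** The form is constant in the chart at x. *)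
Lemma exists_form (x : X) (b0 : extform C n) :
  exists2 b, smooth_form b x & b x = b0.
Proof.
exists (fun y => form_map (toC (invmx (cochange x y))) b0); last first.
  by rewrite cochange1 invmx1 toC1 form_map1.
move=> I; apply: (@near_eq_smoothC_at _ _ (fun=> b0 I)); last exact: smoothC_at_cst.
apply: filterS (near_coord_dom x) => q qx.
rewrite /form_in_chart /in_chart form_map_comp -toC_mul mulVmx ?toC1 ?form_map1 //.
exact: cochange_unit.
Qed.

Lemma form_in_chart_coord (x : X) (b : X -> extform C n) :
  form_in_chart x b (Defs.coord x) = b x.
Proof. by rewrite /form_in_chart in_chart_coord cochange1 toC1 form_map1. Qed.

Lemma form_in_chartM (x : X) (f : X -> R) (b : X -> extform C n) :
  form_in_chart x (fun y => real_complex R (f y) *: b y) =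
  fun q => real_complex R (in_chart x f q) *: form_in_chart x b q.
Proof. by apply/funext => q; rewrite /form_in_chart /in_chart linearZ. Qed.

Lemma metric_in_chart_coord (x : X) :
  metric_in_chart (@metric _ _ X) x (Defs.coord x) = metric x.
Proof. by rewrite /metric_in_chart in_chart_coord cochange1 trmx1 mul1mx mulmx1. Qed.

Lemma form_d_leibniz (f : X -> R) (b : X -> extform C n) (x : X) :
  smooth_fun f x -> smooth_form b x ->
  form_d (fun y => real_complex R (f y) *: b y) x =
  wedge (toC (dfun f x)) (b x) + real_complex R (f x) *: form_d b x.
Proof.
move=> sf sb; rewrite /form_d form_in_chartM ext_d_leibniz.
- by rewrite form_in_chart_coord in_chart_coord.
- by move=> j; exact: smooth_at_derivable.
- by move=> I j; exact: smoothC_at_derivable.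
Qed.

Lemma form_dstar_leibniz (e : X -> 'M[R]_n) (f : X -> R) (b : X -> extform C n) (x : X) :
  (forall y, orthonormal_coframe y (e y)) ->
  smooth_fun f x -> smooth_form b x ->
  form_dstar (fun y => real_complex R (f y) *: b y) x =
  - iprod (toC (dfun f x *m invmx (metric x))) (b x) +
    real_complex R (f x) *: form_dstar b x.
Proof.
move=> he sf sb; rewrite /form_dstar form_in_chartM codiff_leibniz.
- by rewrite form_in_chart_coord in_chart_coord metric_in_chart_coord.
- by rewrite metric_in_chart_coord Defs.metric_sym.
- by rewrite metric_in_chart_coord; exact: metric_det_gt0 (he x).
- apply: filterS (near_coord_dom x) => q qx.
  rewrite /metric_in_chart /in_chart !unitmx_mul unitmx_tr cochange_unit //=.
  by rewrite andbT; exact: metric_unit (he _).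
- by move=> i j k; apply: smooth_at_derivable; exact: metric_smooth.
- by move=> j; exact: smooth_at_derivable.
- by move=> I j; exact: smoothC_at_derivable.
Qed.

Variable W : spinc_bundle X.

Lemma clif_delta_sum (x : X) (v : 'rV[R]_n) :
  clif W x v = \sum_k real_complex R (v ord0 k) *: clif W x (delta_mx ord0 k).
Proof.
rewrite -{1}[v]mulmx1 clif_sum; apply: eq_bigr => k _.
by rewrite mxE row1.
Qed.

Lemma dirac_leibniz (D : connection (frames W)) (f : X -> R) s (x : X) :
  smooth_fun f x -> smooth_section (frames W) s x ->
  dirac D (fun y => real_complex R (f y) *: s y) x =
  clif W x (dfun f x) *m s x + real_complex R (f x) *: dirac D s x.
Proof.
move=> sf ss; rewrite /dirac nabla_leibniz //; last exact: smooth_funC_real.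
rewrite dfunC_real clif_delta_sum mulmx_suml scaler_sumr -big_split /=.
apply: eq_bigr => j _; rewrite linearD linearZ /= mulmxDr -scalemxAr -scalemxAl.
congr (_ + _); rewrite scalemxAr; congr (_ *m _).
by apply/colP => i; rewrite !mxE big_ord1 !mxE mulrC.
Qed.

End RiemannianSymbols.

(** * Adjoints and the concentrating pair *)

Section Adjoints.
Local Open Scope ring_scope.
Local Open Scope classical_set_scope.

(** Uniqueness of adjoints, for a nondegenerate form on the source. *)
Lemma adjoint_eq (C : nzRingType) (U V : lmodType C) (hU : U -> U -> C)
    (hV : V -> V -> C) (f : U -> V) (w : V) (w' : U) :
  (forall b1 b2, (forall a, hU a b1 = hU a b2) -> b1 = b2) ->
  (forall v, hV (f v) w = hU v w') -> adjoint hU hV f w = w'.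
Proof.
move=> inj fw; apply: inj => a; rewrite -fw.
by have /= <- := xgetPex 0 (ex_intro (fun v' => forall v, hV (f v) w = hU v v') w' fw).
Qed.

Variables (R : realType) (r : nat).
Notation C := R[i].

Lemma hermDr (h : 'M[C]_r) s (z : C) t1 t2 :
  herm h s (z *: t1 + t2) = z * herm h s t1 + herm h s t2.
Proof. by rewrite /herm mulmxDr -scalemxAr !mxE. Qed.

Lemma hermDl (h : 'M[C]_r) (z : C) s1 s2 t :
  herm h (z *: s1 + s2) t = Num.conj z * herm h s1 t + herm h s2 t.
Proof.
rewrite /herm (_ : map_mx Num.conj (z *: s1 + s2) =
  Num.conj z *: map_mx Num.conj s1 + map_mx Num.conj s2).
  by rewrite raddfD /= linearZ_LR /= !mulmxDl -!scalemxAl mxE; congr (_ + _); rewrite mxE.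
by apply/colP => i; rewrite !mxE rmorphD rmorphM.
Qed.

Lemma herm_inj (h : 'M[C]_r) : (forall s, s != 0 -> 0 < herm h s s) ->
  forall t1 t2, (forall s, herm h s t1 = herm h s t2) -> t1 = t2.
Proof.
move=> hpos t1 t2 eqt; apply/eqP; rewrite -subr_eq0; apply: contraT => /hpos.
rewrite -[X in herm h _ X]addrC -scaleN1r hermDr eqt mulN1r addNr.
by rewrite ltxx.
Qed.

End Adjoints.

Section ConcentratingPair.
Local Open Scope ring_scope.
Local Open Scope classical_set_scope.
Variables (R : realType) (n : nat) (X : oriented_riemannian R n).
Variable W : spinc_bundle X.
Notation C := R[i].
Notation spinor := 'cV[C]_(2 ^ n./2).
Notation spinor_form := (spinor * extform C n)%type.

(** The action b |-> u /\ b - iota_u b of a covector on forms. *)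
Definition form_clif (x : X) (u : 'rV[R]_n) (b : extform C n) : extform C n :=
  wedge (toC u) b - iprod (toC (u *m invmx (metric x))) b.

(** The symbol of the direct sum of the Dirac operator and d + d^*. *)
Definition dirac_form_symbol (x : X) (u : 'rV[R]_n) (xi : spinor_form) : spinor_form :=
  (clif W x u *m xi.1, form_clif x u xi.2).

Lemma form_clif_linear x u : linear (form_clif x u).
Proof.
move=> a b c; rewrite /form_clif wedge_linear iprod_linear scalerBr.
by rewrite opprD addrACA.
Qed.

Lemma form_clifN x u b : form_clif x u (- b) = - form_clif x u b.
Proof.
rewrite /form_clif [wedge _ (- b)]raddfN [iprod _ (- b)]raddfN /=.
by rewrite opprK opprB addrC.
Qed.

Lemma form_clif_linearl x (a : R) u v b :
  form_clif x (a *: u + v) b =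
  real_complex R a *: form_clif x u b + form_clif x v b.
Proof.
have toCP (y z : 'rV[R]_n) : toC (a *: y + z) = real_complex R a *: toC y + toC z.
  by rewrite /toC map_mxD map_mxZ.
rewrite /form_clif mulmxDl -scalemxAl !toCP wedge_linearl iprod_linearl.
by rewrite scalerBr opprD addrACA.
Qed.

Lemma is_symbol_dirac_form (D : connection (frames W)) (e : X -> 'M[R]_n) :
  (forall x, orthonormal_coframe x (e x)) ->
  is_symbol (smooth_spinor_form W) (dirac_form D) dirac_form_symbol.
Proof.
move=> he; split.
- move=> x u a v w; congr pair; last exact: form_clif_linear.
  by rewrite /= mulmxDr -scalemxAr.
- move=> x a u v xi; congr pair; last exact: form_clif_linearl.
  by rewrite /= clif_linear mulmxDl -scalemxAl.
move=> x f xi sf [ss sb]; congr pair; first exact: dirac_leibniz.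
rewrite /= form_d_leibniz // (form_dstar_leibniz he) // addrACA.
by rewrite -scalerDr.
Qed.

(** A differential operator of order one has only one symbol, since f and xi
    can be chosen with any given values of df and xi at x. *)
Lemma symbol_unique (D : (X -> spinor_form) -> X -> spinor_form) s1 s2 :
  is_symbol (smooth_spinor_form W) D s1 ->
  is_symbol (smooth_spinor_form W) D s2 ->
  forall x u xi, s1 x u xi = s2 x u xi.
Proof.
move=> [_ _ D1] [_ _ D2] x u [s0 b0].
have [f sf <-] := exists_dfun x u.
have [s ss <-] := exists_section x s0 (frames_bundle W).
have [b sb <-] := exists_form x b0.
have sxi : smooth_spinor_form W (fun y => (s y, b y)) x by [].
have := D1 x f _ sf sxi; rewrite (D2 x f _ sf sxi).
by move/addIr.
Qed.

Section Fibre.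
Variables (x : X) (e : X -> 'M[R]_n) (psi : X -> spinor).
Hypothesis he : orthonormal_coframe x (e x).
Local Notation g := (metric x).
Local Notation hW := (herm (metricW W x)).
Local Notation P := (Ppsi W e psi x).
Local Notation Pstar := (adjoint (form_herm g) hW P).
Local Notation H := (spinor_form_herm W x).

Lemma hermWC s t : hW t s = Num.conj (hW s t).
Proof. by have [] := metricW_hermitian W; move=> ->. Qed.

Lemma hermW_inj t1 t2 : (forall s, hW s t1 = hW s t2) -> t1 = t2.
Proof. by apply: herm_inj; have [_ + _] := metricW_hermitian W; apply. Qed.

Lemma form_hermM_inj b1 b2 :
  (forall a, form_herm g a b1 = form_herm g a b2) -> b1 = b2.
Proof.
by apply: form_herm_inj; [exact: Defs.metric_sym | exact: metric_unit he].
Qed.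

Lemma form_herm0l b : form_herm g 0 b = 0.
Proof.
have := form_hermDl (-1) 0 0 b (Defs.metric_sym x).
by rewrite scaleN1r addNr rmorphN rmorph1 mulN1r addNr.
Qed.

Lemma form_herm0r a : form_herm g a 0 = 0.
Proof. by rewrite form_hermC ?Defs.metric_sym // form_herm0l rmorph0. Qed.

Lemma form_hermNl a b : form_herm g (- a) b = - form_herm g a b.
Proof.
rewrite -scaleN1r -[_ *: a]addr0 form_hermDl ?Defs.metric_sym //.
by rewrite form_herm0l addr0 rmorphN rmorph1 mulN1r.
Qed.

Lemma form_hermNr a b : form_herm g a (- b) = - form_herm g a b.
Proof.
rewrite -scaleN1r -[_ *: b]addr0 form_hermDr ?Defs.metric_sym //.
by rewrite form_herm0r addr0 mulN1r.
Qed.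

Lemma form_hermBl a1 a2 b :
  form_herm g (a1 - a2) b = form_herm g a1 b - form_herm g a2 b.
Proof.
by rewrite -[a1]scale1r form_hermDl ?Defs.metric_sym // form_hermNl rmorph1 !mul1r
  scale1r.
Qed.

Lemma form_hermBr a b1 b2 :
  form_herm g a (b1 - b2) = form_herm g a b1 - form_herm g a b2.
Proof.
by rewrite -[b1]scale1r form_hermDr ?Defs.metric_sym // form_hermNr mul1r scale1r.
Qed.

Lemma form_clif_skew u a b :
  form_herm g (form_clif x u a) b = - form_herm g a (form_clif x u b).
Proof.
have symg := Defs.metric_sym x.
rewrite form_hermBl form_hermBr (form_herm_wedge _ _ _ symg).
by rewrite (form_herm_iprod _ _ _ symg) opprB.
Qed.

Lemma Ppsi_linear : linear P.
Proof.
move=> z a b; rewrite /Ppsi !clif_formE linearP [cliff_sum _ _]linearP.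
by rewrite mulmxDl scalemxAl.
Qed.

(** The adjoint of P_psi exists: the fibre of forms is finite dimensional. *)
Lemma Ppsi_adjointE a s : hW (P a) s = form_herm g a (Pstar s).
Proof.
have [||z a1 a2|b Pb] := @form_herm_riesz R n g (fun b => hW (P b) s).
- exact: Defs.metric_sym.
- exact: metric_unit he.
- by rewrite Ppsi_linear hermDl.
by rewrite (adjoint_eq (w' := b)) // => b1 b2; exact: form_hermM_inj.
Qed.

Lemma Ppsi_form_clif u b : P (form_clif x u b) = clif W x u *m P b.
Proof. by rewrite /Ppsi clif_form_wedge // mulmxA. Qed.

(** Adjoint of Ppsi_form_clif, as clif and form_clif are both skew. *)
Lemma Ppsi_adjoint_clif u s : Pstar (clif W x u *m s) = form_clif x u (Pstar s).
Proof.
apply: form_hermM_inj => a; rewrite -Ppsi_adjointE.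
rewrite -[LHS]opprK -clif_skew -Ppsi_form_clif Ppsi_adjointE form_clif_skew.
by rewrite opprK.
Qed.

Lemma spinor_form_herm_inj v1 v2 : (forall a, H a v1 = H a v2) -> v1 = v2.
Proof.
case: v1 v2 => [s1 b1] [s2 b2] eqv; congr pair.
  apply: hermW_inj => s; have := eqv (s, 0).
  by rewrite /spinor_form_herm /= !form_herm0l !addr0.
apply: form_hermM_inj => b; have := eqv (0, b); rewrite /spinor_form_herm /=.
have h0 t : hW 0 t = 0.
  have := hermDl (metricW W x) (-1) 0 0 t.
  by rewrite scaleN1r addNr rmorphN rmorph1 mulN1r addNr.
by rewrite !h0 !add0r.
Qed.

Lemma hermWNr s t : hW s (- t) = - hW s t.
Proof.
have h0 : hW s 0 = 0.
  by have := hermDr (metricW W x) s (-1) 0 0; rewrite scaleN1r addNr mulN1r addNr.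
by rewrite -scaleN1r -[_ *: t]addr0 hermDr h0 addr0 mulN1r.
Qed.

Lemma spinor_form_hermNr a b : H a (- b) = - H a b.
Proof. by rewrite /spinor_form_herm /= hermWNr form_hermNr opprD. Qed.

Lemma spinor_form_adjoint_skew (f : spinor_form -> spinor_form) :
  (forall a b, H (f a) b = - H a (f b)) -> forall b, adjoint H H f b = - f b.
Proof.
move=> fskew b; apply: adjoint_eq => [|v]; first exact: spinor_form_herm_inj.
by rewrite spinor_form_hermNr fskew.
Qed.

Lemma Apsi_skew a b : H (Apsi W e psi x a) b = - H a (Apsi W e psi x b).
Proof.
rewrite /spinor_form_herm /= form_hermNl form_hermNr Ppsi_adjointE opprB.
congr (_ - _); rewrite hermWC Ppsi_adjointE.
by rewrite [LHS]form_hermC // Defs.metric_sym.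
Qed.

Lemma dirac_form_symbol_skew u a b :
  H (dirac_form_symbol x u a) b = - H a (dirac_form_symbol x u b).
Proof. by rewrite /spinor_form_herm /= clif_skew form_clif_skew opprD. Qed.

Lemma Apsi_dirac_form_symbol u a :
  Apsi W e psi x (dirac_form_symbol x u a) =
  dirac_form_symbol x u (Apsi W e psi x a).
Proof.
rewrite /Apsi /dirac_form_symbol /= Ppsi_form_clif Ppsi_adjoint_clif.
by rewrite form_clifN.
Qed.

End Fibre.

End ConcentratingPair.

Theorem lemma4p2 (R : realType) (n : nat) (X : oriented_riemannian R n)
    (W : spinc_bundle X)
    (A : connection (det_frames (frames W)))
    (hA : hermitian_connection (det_metric W) A)
    (D : connection (frames W)) (hD : spinc_connection A D)
    (psi : X -> 'cV[R[i]]_(2 ^ n./2))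
    (hpsi : forall x : X, smooth_section (frames W) psi x)
    (e : X -> 'M[R]_n) (he : forall x : X, orthonormal_coframe x (e x)) :
  (exists sigma, is_symbol (smooth_spinor_form W) (dirac_form D) sigma) /\
  (forall sigma, is_symbol (smooth_spinor_form W) (dirac_form D) sigma ->
     concentrating_pair (spinor_form_herm W) (spinor_form_herm W)
       sigma (Apsi W e psi)).
Proof.
have symb := is_symbol_dirac_form D he.
split; first by exists (@dirac_form_symbol R n X W).
move=> sigma sigmaP x u xi /=.
have -> : sigma x u = dirac_form_symbol W x u.
  by apply/funext => a; exact: symbol_unique sigmaP symb x u a.
rewrite (spinor_form_adjoint_skew (he x) (Apsi_skew W psi (he x))).
rewrite (spinor_form_adjoint_skew (he x) (@dirac_form_symbol_skew _ _ _ W x u)).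
by rewrite (Apsi_dirac_form_symbol W psi (he x)).
Qed.
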